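(* Let $(\pi,\omega)$ be a $\Pi\Omega$-structure on a Lie algebroid $(A,[\cdot,\cdot],\rho)$. Then $\mathcal N=\underline\omega+\pi$ is a co-boundary Nijenhuis form, with curvature, with respect to the multiplicative graded Lie algebra structure $l_2^{[\cdot,\cdot]}$ on the graded vector space $\Gamma(\wedge A)[2]$, with square $\underline N$, where $N=\pi^\#\circ\omega^\flat$. The deformed structure $[\mathcal N,l_2^{[\cdot,\cdot]}]_{_{RN}}$ is $-l_1^{[\cdot,\cdot],\pi}$, where $l_1^{[\cdot,\cdot],\pi}(P)=[\pi,P]_{_{SN}}$.
   Context: $(A,[\cdot,\cdot],\rho)$ is a Lie algebroid over $M$ with Chevalley–Eilenberg differential $\mathrm d^A$. A $\Pi\Omega$-structure is a pair $(\pi,\omega)$ with $\pi\in\Gamma(\wedge^2A)$ Poisson, i.e. $[\pi,\pi]_{_{SN}}=0$, and $\omega\in\Gamma(\wedge^2A^* )$ with $\mathrm d^A\omega=0$. With $(X\wedge Y)(\alpha,\beta)=\alpha(X)\beta(Y)-\alpha(Y)\beta(X)$, $\pi^\#:\Gamma(A^* )\to\Gamma(A)$ is given by $\langle\beta,\pi^\#\alpha\rangle=\pi(\alpha,\beta)$; $\omega^\flat:\Gamma(A)\to\Gamma(A^* )$ is given by $\langle\omega^\flat(X),Y\rangle=\omega(X,Y)$. $\Gamma(\wedge A)[2]$: elements of $\Gamma(\wedge^pA)$ have degree $p-2$. Extensions by derivation: for a $(1,1)$-tensor $N$, $\underline N(f)=0$ for functions, $\underline N(P_1\wedge\cdots\wedge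 P_p)=\sum_iP_1\wedge\cdots\wedge N(P_i)\wedge\cdots\wedge P_p$; for a $2$-form $\omega$, $\underline\omega$ is the graded symmetric bilinear map of degree $0$ vanishing when an argument is a function and $$\underline\omega(P,Q)=\sum_{i=1}^p\sum_{j=1}^q(-1)^{q+i+j+1}\omega(P_i,Q_j)\,\widehat{P_i}\wedge\widehat{Q_j}$$ for $P=P_1\wedge\cdots\wedge P_p$, $Q=Q_1\wedge\cdots\wedge Q_q$, where $\widehat{P_i}$ omits the factor $P_i$. The Schouten–Nijenhuis bracket is the unique bilinear bracket on $\Gamma(\wedge A)$ with $[X,f]_{_{SN}}=\rho(X)f$, $[X,Y]_{_{SN}}=[X,Y]$ for $X,Y\in\Gamma(A)$, $[f,g]_{_{SN}}=0$, and for $P\in\Gamma(\wedge^{p}A)$, $Q\in\Gamma(\wedge^qA)$: $[P,Q]_{_{SN}}=-(-1)^{(p-1)(q-1)}[Q,P]_{_{SN}}$, $[P,Q\wedge R]_{_{SN}}=[P,Q]_{_{SN}}\wedge R+(-1)^{(p-1)q}Q\wedge[P,R]_{_{SN}}$. Set $l_2^{[\cdot,\cdot]}(P,Q)=(-1)^{p-1}[P,Q]_{_{SN}}$ for $P\in\Gamma(\wedge^pA)$, a graded symmetric bilinear map of degree $1$. On a graded vector space $E$, a symmetric vector valued $k$-form ($k\ge0$) is a graded symmetric $k$-linear map $K$ (exchanging adjacent arguments $X,Y$ gives $(-1)^{|X||Y|}$), a $0$-form being an element of $E$; it has degree $\bar K$ if $|K(X_1,\dots,X_k)|=\sum|X_i|+\bar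 K$. For a $k$-form $K$ and $l$-form $L$, $$\iota_KL(X_1,\dots,X_{k+l-1})=\sum_{\sigma\in Sh(k,l-1)}\epsilon(\sigma)L(K(X_{\sigma(1)},\dots,X_{\sigma(k)}),X_{\sigma(k+1)},\dots,X_{\sigma(k+l-1)})$$ (unshuffles, Koszul sign; $\iota_KL=0$ if $l=0$, $\iota_KL=L(K,\dots)$ if $k=0$), and $[K,L]_{_{RN}}=\iota_KL-(-1)^{\bar K\bar L}\iota_LK$, extended bilinearly. For $\mu$ of degree $1$, $\mathcal N$ of degree $0$ is co-boundary Nijenhuis with respect to $\mu$ with square $\mathcal K$ ($\mathcal K$ of degree $0$) if $[\mathcal N,[\mathcal N,\mu]_{_{RN}}]_{_{RN}}=[\mathcal K,\mu]_{_{RN}}$; ''with curvature'' means $\mathcal N$ has a $0$-form component (here $\pi$).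
   Formalization: The extension of ω to multivectors is taken with sign (-1)^{p+i+j} instead of the printed (-1)^{q+i+j+1}; with the printed sign the claim fails, e.g. on TR³ with π=0, ω=dx∧dy, arguments z, ∂x, ∂z∧∂y. *)

(* Defs.v *)
From HB Require Import structures.
From mathcomp Require Import all_boot all_order all_algebra perm.
From mathcomp Require Import boolp classical_sets functions reals topology.
From mathcomp Require Import normedtype derive.

Set Implicit Arguments.
Unset Strict Implicit.
Unset Printing Implicit Defensive.

Import Order.TTheory GRing.Theory Num.Theory.
Import numFieldNormedType.Exports.

Local Open Scope classical_set_scope.
Local Open Scope ring_scope.

(** * Smooth manifolds and their algebras of smooth functions *)

Section SmoothOn.
Context {R : realType} {n : nat}.
Implicit Types (U : set 'rV[R]_n) (f g : 'rV[R]_n -> R).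

Fixpoint Ck_on (k : nat) U f : Prop :=
  (forall u, U u -> {for u, continuous f}) /\
  if k is k'.+1 then
    forall i : 'I_n, (forall u, U u -> derivable f u (delta_mx 0 i)) /\
                     Ck_on k' U (fun u => 'D_(delta_mx 0 i) f u)
  else True.

Definition smooth_on U f : Prop := forall k, Ck_on k U f.

Lemma Ck_onS k U f : Ck_on k.+1 U f -> Ck_on k U f.
Proof.
elim: k f => [|k IH] f [cf df]; first by split.
by split=> // i; have [? ?] := df i; split=> //; apply: IH.
Qed.

Lemma Ck_on_ext k U f g : open U -> (forall u, U u -> f u = g u) ->
  Ck_on k U f -> Ck_on k U g.
Proof.
move=> oU; elim: k f g => [|k IH] f g fg [cf df].
all: have nfg u : U u -> \forall v \near u, f v = g v
  by move=> Uu; apply: (filterS fg); exact: open_nbhs_nbhs.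
all: have cg u : U u -> {for u, continuous g}
  by move=> Uu; have := cf u Uu; rewrite /prop_for /continuous_at -(fg u Uu);
     apply: cvg_trans; exact: (near_eq_cvg (F := nbhs u) (nfg u Uu)).
  by split.
split=> // i; have [dfi Dfi] := df i; split=> [u Uu|].
  by apply: (near_eq_derivable _ (dfi u Uu)); exact: nfg.
by apply: IH Dfi => u Uu; apply: near_eq_derive; exact: nfg.
Qed.

Lemma Ck_on_cst k U (c : R) : Ck_on k U (cst c).
Proof.
elim: k c => [|k IH] c; first by split=> // u _; exact: cst_continuous.
split=> [u _|i]; first exact: cst_continuous.
split=> [u _|]; first exact: derivable_cst.
have -> : (fun u : 'rV[R]_n => 'D_(delta_mx 0 i) (cst c) u) = cst (0 : R)
  by apply: boolp.funext => u; exact: derive_cst.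
exact: IH.
Qed.

Lemma Ck_onB k U f g : open U -> Ck_on k U f -> Ck_on k U g ->
  Ck_on k U (f - g).
Proof.
move=> oU; elim: k f g => [|k IH] f g [cf df] [cg dg].
all: have cfg u : U u -> {for u, continuous (f - g)}
  by move=> Uu; exact: continuousB (cf u Uu) (cg u Uu).
  by split.
split=> // i; have [dfi Dfi] := df i; have [dgi Dgi] := dg i.
split=> [u Uu|]; first by apply: derivableB; [exact: dfi|exact: dgi].
apply: Ck_on_ext (IH _ _ Dfi Dgi) => // u Uu.
by rewrite deriveB; [|exact: dfi|exact: dgi].
Qed.

Lemma Ck_onM k U f g : open U -> Ck_on k U f -> Ck_on k U g ->
  Ck_on k U (f * g).
Proof.
move=> oU; elim: k f g => [|k IH] f g Cf Cg.
all: have [cf df] := Cf; have [cg dg] := Cg.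
all: have cfg u : U u -> {for u, continuous (f * g)}
  by move=> Uu; exact: continuousM (cf u Uu) (cg u Uu).
  by split.
split=> // i; have [dfi Dfi] := df i; have [dgi Dgi] := dg i.
split=> [u Uu|]; first by apply: derivableM; [exact: dfi|exact: dgi].
have CfS := Ck_onS Cf; have CgS := Ck_onS Cg.
have H := Ck_onB oU (IH _ _ CfS Dgi)
            (Ck_onB oU (Ck_on_cst k U 0) (IH _ _ CgS Dfi)).
apply: Ck_on_ext H => // u Uu.
rewrite deriveM; [|exact: dfi|exact: dgi].
by rewrite /= !fctE opprB subr0.
Qed.

End SmoothOn.

Record smooth_manifold (R : realType) (n : nat) := SmoothManifold {
  mpoint :> topologicalType;
  mhausdorff : hausdorff_space mpoint;
  msecond_countable : @second_countable mpoint;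
  chart : Type;
  dom : chart -> set mpoint;
  coord : chart -> mpoint -> 'rV[R]_n;
  param : chart -> 'rV[R]_n -> mpoint;
  dom_open : forall i, open (dom i);
  dom_cover : forall x, exists i, dom i x;
  img_open : forall i, open (coord i @` dom i);
  coordK : forall i x, dom i x -> param i (coord i x) = x;
  coord_continuous : forall i x, dom i x -> {for x, continuous (coord i)};
  param_continuous :
    forall i u, (coord i @` dom i) u -> {for u, continuous (param i)};
  transition_smooth : forall i j (k : 'I_n),
    smooth_on (coord i @` (dom i `&` dom j))
              (fun u => coord j (param i u) 0 k)
}.

Section SmoothFunctions.
Context {R : realType} {n : nat} (M : smooth_manifold R n).

Definition smooth (f : M -> R) : Prop :=
  forall i : chart M, smooth_on (@coord _ _ M i @` dom i) (f \o param i).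

Definition smooth_pred : {pred M -> R} := fun f => `[< smooth f >].

Lemma smooth_subring_closed : subring_closed smooth_pred.
Proof.
split=> [|f g /asboolP sf /asboolP sg|f g /asboolP sf /asboolP sg];
  apply/asboolP => i k.
- exact: Ck_on_cst.
- by have := Ck_onB (@img_open _ _ M i) (sf i k) (sg i k).
- by have := Ck_onM (@img_open _ _ M i) (sf i k) (sg i k).
Qed.

HB.instance Definition _ :=
  GRing.isSubringClosed.Build (M -> R) smooth_pred smooth_subring_closed.

(** [C^oo(M)]. *)
Record Cinf := MkCinf { Cinf_fun :> M -> R; CinfP : Cinf_fun \in smooth_pred }.

HB.instance Definition _ := [isSub for Cinf_fun].
HB.instance Definition _ := [Choice of Cinf by <:].
HB.instance Definition _ :=
  GRing.SubChoice_isSubComPzRing.Build (M -> R) smooth_pred Cinf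
    smooth_subring_closed.

Lemma smooth_cst (r : R) : (cst r : M -> R) \in smooth_pred.
Proof. by apply/asboolP => i k; exact: Ck_on_cst. Qed.

Definition Cinf_cst (r : R) : Cinf := MkCinf (smooth_cst r).

End SmoothFunctions.

(** [over_reals V] is the [C^oo(M)]-module [V] seen as a real vector space. *)

Section OverReals.
Context {R : realType} {n : nat} {M : smooth_manifold R n}.

Definition over_reals (V : lmodType (Cinf M)) : Type := V.

Variable V : lmodType (Cinf M).

HB.instance Definition _ := GRing.Zmodule.on (over_reals V).

Definition rscale (r : R) (x : over_reals V) : over_reals V :=
  Cinf_cst M r *: (x : V).

Lemma rscaleA a b x : rscale a (rscale b x) = rscale (a * b) x.
Proof. by rewrite /rscale scalerA; congr (_ *: _); exact: val_inj. Qed.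

Lemma rscale1 : left_id 1 rscale.
Proof.
move=> x; rewrite -[RHS](scale1r (x : V)); congr (_ *: _); exact: val_inj.
Qed.

Lemma rscaleDr : right_distributive rscale +%R.
Proof. by move=> a x y; exact: scalerDr. Qed.

Lemma rscaleDl x : {morph rscale^~ x : a b / a + b}.
Proof.
move=> a b; rewrite -[RHS]scalerDl; congr (_ *: _); exact: val_inj.
Qed.

HB.instance Definition _ := GRing.Zmodule_isLmodule.Build R (over_reals V)
  rscaleA rscale1 rscaleDr rscaleDl.

End OverReals.

(** * Lie algebroids *)

(** By the Serre-Swan theorem a vector bundle [A] over [M] is encoded by the
    finitely generated projective [C^oo(M)]-module [Gamma(A)], and the vector
    field [rho(X)] by the derivation [f |-> rho(X) f] of [C^oo(M)]. *)
Record lie_algebroid (R : realType) (n : nat) (M : smooth_manifold R n) :=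
LieAlgebroid {
  sections :> lmodType (Cinf M);
  sections_projective :
    exists (m : nat) (e : 'I_m -> sections) (e' : 'I_m -> {scalar sections}),
      forall X, X = \sum_k e' k X *: e k;
  bracket : sections -> sections -> sections;
  anchor : sections -> Cinf M -> Cinf M;
  anchor_linear : forall f, scalar (anchor^~ f);
  anchor_Rlinear : forall X (r : R) f g,
    anchor X (Cinf_cst M r * f + g) = Cinf_cst M r * anchor X f + anchor X g;
  anchor_derivation : forall X f g,
    anchor X (f * g) = anchor X f * g + f * anchor X g;
  anchor_bracket : forall X Y f,
    anchor (bracket X Y) f = anchor X (anchor Y f) - anchor Y (anchor X f);
  bracket_Rlinear : forall X (r : R) Y Z,
    bracket X (Cinf_cst M r *: Y + Z) =
      Cinf_cst M r *: bracket X Y + bracket X Z;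
  bracketC : forall X Y, bracket X Y = - bracket Y X;
  bracket_jacobi : forall X Y Z,
    bracket X (bracket Y Z) + bracket Y (bracket Z X)
      + bracket Z (bracket X Y) = 0;
  bracket_leibniz : forall X f Y,
    bracket X (f *: Y) = anchor X f *: Y + f *: bracket X Y
}.

Section Forms.
Context {R : realType} {n : nat} {M : smooth_manifold R n}.
Variable A : lie_algebroid M.

(** Sections of the dual of [A] are [{scalar A}]. *)
Record two_form := TwoForm {
  two_form_fun :> A -> A -> Cinf M;
  two_form_linear : forall X, scalar (two_form_fun X);
  two_formC : forall X Y, two_form_fun X Y = - two_form_fun Y X
}.

Variable omega : two_form.

(** The Chevalley-Eilenberg differential of [omega] vanishes. *)
Definition closed_form : Prop := forall X Y Z : A,
  anchor X (omega Y Z) - anchor Y (omega X Z) + anchor Z (omega X Y)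
    - omega (bracket X Y) Z + omega (bracket X Z) Y - omega (bracket Y Z) X
  = 0.

Definition flat_fun (X : A) : A -> Cinf M := omega X.

HB.instance Definition _ X :=
  GRing.isLinear.Build (Cinf M) A (Cinf M) *%R (flat_fun X)
    (two_form_linear omega X).

(** [omega^flat]. *)
Definition flat (X : A) : {scalar A} := flat_fun X.

End Forms.

(** * The exterior algebra [Gamma(/\ A)] *)

Section Exterior.
Context {R : realType} {n : nat} {M : smooth_manifold R n}.

Definition ext_power (V : lmodType (Cinf M)) (E : algType (Cinf M))
    (inj : V -> E) (p : nat) (P : E) : Prop :=
  exists (m : nat) (c : 'I_m -> Cinf M) (X : 'I_m -> 'I_p -> V),
    P = \sum_(k < m) c k *: \prod_(i < p) inj (X k i).

(** The exterior algebra of [V] over [C^oo(M)], up to isomorphism;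
    [ext_generated] is the uniqueness part of the universal property.
    The exterior product is the product [*] of the algebra. *)
Record exterior_algebra (V : lmodType (Cinf M)) := ExteriorAlgebra {
  ext :> algType (Cinf M);
  inj : {linear V -> ext};
  inj_square : forall X, inj X * inj X = 0;
  ext_generated : forall P : ext, exists (d : nat) (Q : nat -> ext),
    (forall p, ext_power inj p (Q p)) /\ P = \sum_(p < d) Q p;
  ext_universal : forall (B : algType (Cinf M)) (f : {linear V -> B}),
    (forall X, f X * f X = 0) ->
    exists g : {lrmorphism ext -> B}, forall X, g (inj X) = f X
}.

Context {V : lmodType (Cinf M)} (E : exterior_algebra V).

Definition wedge (p : nat) (X : 'I_p -> V) : E := \prod_(i < p) inj E (X i).

Definition wedge_omit (p : nat) (X : 'I_p -> V) (j : 'I_p) : E :=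
  \prod_(i < p | i != j) inj E (X i).

(** The grading of [Gamma(/\ A)[2]]: degree [p - 2] on [Gamma(/\^p A)]. *)
Definition shifted_degree (d : int) (P : over_reals E) : Prop :=
  match (d + 2)%R with
  | Posz p => ext_power (inj E) p P
  | Negz _ => P = 0
  end.

(** [B] is the bivector field [pi] seen as a bilinear form on the dual of [V],
    where [(X /\ Y)(alpha, beta) = alpha(X) beta(Y) - alpha(Y) beta(X)]. *)
Definition bivector_as_form (pi : E)
    (B : {scalar V} -> {scalar V} -> Cinf M) : Prop :=
  exists (m : nat) (X Y : 'I_m -> V),
    pi = \sum_(k < m) inj E (X k) * inj E (Y k) /\
    forall alpha beta : {scalar V}, B alpha beta =
      \sum_(k < m) (alpha (X k) * beta (Y k) - alpha (Y k) * beta (X k)).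

(** [Nu] is the extension by derivation of [N : V -> V]. *)
Definition derivation_extension (N : V -> V) (Nu : E -> E) : Prop :=
  [/\ {morph Nu : P Q / P + Q},
      forall f : Cinf M, Nu f%:A = 0 &
      forall p (X : 'I_p -> V),
        Nu (wedge X) =
          \sum_(i < p) wedge (fun j => if j == i then N (X j) else X j)].

End Exterior.

Definition koszul (z : int) : int := (-1) ^ z.

(** * Symmetric vector valued forms and the Richardson-Nijenhuis bracket *)

Section RichardsonNijenhuis.
Context {R : realType} (V : lmodType R) (gr : int -> V -> Prop).

(** [gr d x] means that [x] is homogeneous of degree [d].  An argument [(d, x)]
    is an element [x] tagged with such a degree.  A sum of symmetric vector valued forms of various arities
    is a function on lists of arguments: its [k]-form component is its
    restriction to the lists of length [k]. *)
Definition vform := seq (int * V) -> V.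

Definition homogeneous (s : seq (int * V)) : Prop :=
  forall a, a \in s -> gr a.1 a.2.

Definition form_eq (K L : vform) : Prop :=
  forall s, homogeneous s -> K s = L s.

Definition total_degree (s : seq (int * V)) : int := \sum_(a <- s) a.1.

Definition symmetric_form (kbar : int) (K : vform) : Prop :=
  [/\ forall s, homogeneous s -> gr (total_degree s + kbar) (K s),
      forall s a b t, homogeneous (s ++ a :: b :: t) ->
        K (s ++ a :: b :: t) = K (s ++ b :: a :: t) *~ koszul (a.1 * b.1) &
      forall s d (r : R) x y t,
        homogeneous (s ++ (d, x) :: t) -> homogeneous (s ++ (d, y) :: t) ->
        K (s ++ (d, r *: x + y) :: t) =
          r *: K (s ++ (d, x) :: t) + K (s ++ (d, y) :: t)].

Definition unshuffles (m k : nat) : {set 'S_m} :=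
  [set s : 'S_m | [forall i : 'I_m, forall j : 'I_m,
     (i < j)%N && ((j < k)%N || (k <= i)%N) ==> (s i < s j)%N]].

Definition permute (X : seq (int * V)) (s : 'S_(size X)) : seq (int * V) :=
  [seq nth (0, 0) X (s i) | i <- enum 'I_(size X)].

(** The sign is the product of [(-1)^(|X_a| |X_b|)] over the inversions. *)
Definition koszul_sign (X : seq (int * V)) (s : 'S_(size X)) : int :=
  \prod_(i < size X) \prod_(j < size X | (i < j)%N && (s j < s i)%N)
    koszul ((nth (0, 0) X (s i)).1 * (nth (0, 0) X (s j)).1).

(** [iota_K L] for [K] of degree [kbar], extended bilinearly to sums of forms
    of various arities: [k] is the arity of the component of [K] involved. *)
Definition insertion (kbar : int) (K L : vform) : vform := fun X =>
  \sum_(k < (size X).+1) \sum_(s in unshuffles (size X) k)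
    let Y := take k (permute s) in let Z := drop k (permute s) in
    L ((total_degree Y + kbar, K Y) :: Z) *~ koszul_sign s.

Definition rn_bracket (kbar lbar : int) (K L : vform) : vform := fun X =>
  insertion kbar K L X - insertion lbar L K X *~ koszul (kbar * lbar).

(** [N] is co-boundary Nijenhuis with respect to [mu], with square [K]. *)
Definition coboundary_nijenhuis (mu N K : vform) : Prop :=
  [/\ symmetric_form 1 mu, symmetric_form 0 N, symmetric_form 0 K &
      form_eq (rn_bracket 0 1 N (rn_bracket 0 1 N mu)) (rn_bracket 0 1 K mu)].

Definition zero_form (v : V) : vform := fun X => if X is [::] then v else 0.

Definition unary_form (f : V -> V) : vform := fun X =>
  if X is [:: (_, x)] then f x else 0.

Definition binary_form (f : V -> V -> V) : vform := fun X =>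
  if X is [:: (_, x); (_, y)] then f x y else 0.

Definition curvature (K : vform) : V := K [::].

End RichardsonNijenhuis.

(** * The Schouten-Nijenhuis bracket and the structures on [Gamma(/\ A)[2]] *)

Section Schouten.
Context {R : realType} {n : nat} {M : smooth_manifold R n}.
Context {A : lie_algebroid M} (E : exterior_algebra A).

Definition schouten_nijenhuis (SN : E -> E -> E) : Prop :=
  (forall (r : R) P Q T,
     SN P (Cinf_cst M r *: Q + T) = Cinf_cst M r *: SN P Q + SN P T) /\
  (forall (r : R) P Q T,
     SN (Cinf_cst M r *: P + Q) T = Cinf_cst M r *: SN P T + SN Q T) /\
  [/\ forall X f, SN (inj E X) f%:A = (anchor X f)%:A,
      forall X Y, SN (inj E X) (inj E Y) = inj E (bracket X Y),
      forall f g : Cinf M, SN f%:A g%:A = 0,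
      forall p q P Q, ext_power (inj E) p P -> ext_power (inj E) q Q ->
        SN P Q = - (SN Q P *~ koszul ((p%:Z - 1) * (q%:Z - 1))) &
      forall p q P Q T, ext_power (inj E) p P -> ext_power (inj E) q Q ->
        SN P (Q * T) = SN P Q * T + (Q * SN P T) *~ koszul ((p%:Z - 1) * q%:Z)].

(** [omu] is the extension of the 2-form [omega].  The sign [(-1)^(p+i+j)],
    with [i] and [j] counted from 1, is the one compatible with the other
    conventions: for [(-1)^(q+i+j+1)] the bracket of [omu] with [l2] would not
    vanish for closed [omega]. *)
Definition two_form_extension (omega : two_form A) (omu : E -> E -> E) : Prop :=
  [/\ forall P, {morph omu P : Q T / Q + T},
      forall Q, {morph omu^~ Q : P T / P + T},
      forall (f : Cinf M) P, omu f%:A P = 0 /\ omu P f%:A = 0 &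
      forall p q (X : 'I_p -> A) (Y : 'I_q -> A),
        omu (wedge E X) (wedge E Y) =
          \sum_(i < p) \sum_(j < q)
            (omega (X i) (Y j) *: (wedge_omit E X i * wedge_omit E Y j))
              *~ koszul (p%:Z + i.+1%:Z + j.+1%:Z)].

Definition poisson (SN : E -> E -> E) (pi : E) : Prop :=
  ext_power (inj E) 2 pi /\ SN pi pi = 0.

Definition PiOmega_structure (SN : E -> E -> E) (pi : E) (omega : two_form A) :
  Prop := poisson SN pi /\ closed_form omega.

(** [l2(P, Q) = (-1)^(p-1) [P, Q]] for [P] of exterior degree [p = d + 2]. *)
Definition l2 (SN : E -> E -> E) : vform (over_reals E) := fun X =>
  if X is [:: (d, P); (_, Q)] then SN P Q *~ koszul (d + 2 - 1) else 0.

Definition l1 (SN : E -> E -> E) (pi : E) : vform (over_reals E) :=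
  unary_form (SN pi : over_reals E -> over_reals E).

(** The sum of the 2-form [omu] and the 0-form [pi]. *)
Definition form_with_curvature (omu : E -> E -> E) (pi : E) :
    vform (over_reals E) := fun X =>
  binary_form (omu : over_reals E -> over_reals E -> over_reals E) X
    + zero_form (pi : over_reals E) X.

End Schouten.

(* Main.v *)
(** Tag an element of exterior degree p by p - 2.  For tagged homogeneous a, b
    the map c |-> [omu, l2](a, b, c) is a signed sum of the derivations omu(P, .)
    and l2(P, .) and of graded commutators of these, hence itself a graded
    derivation of the exterior algebra.  It is moreover invariant, up to sign,
    under cyclic rotation of (a, b, c), so [omu, l2] vanishes as soon as it does
    on functions and sections of A, where it is, up to sign, the
    Chevalley-Eilenberg differential of omega.  Hence [omu + pi, l2] reduces to
    the insertion of pi in l2.  Both omu(pi, .) and -Nu are derivations with the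
    same values on generators; substituting pi for a in [omu, l2](a, b, c) = 0
    then gives the identity for the square, the 0-form component being
    [pi, pi] = 0. *)
Require Import Defs.
From mathcomp Require Import all_boot all_order all_algebra perm ssrAC.
From mathcomp Require Import boolp classical_sets functions reals topology.
From mathcomp Require Import normedtype derive.
From mathcomp Require Import zify.

Set Implicit Arguments.
Unset Strict Implicit.
Unset Printing Implicit Defensive.

Import Order.TTheory GRing.Theory Num.Theory.
Local Open Scope ring_scope.

(** * Parities, signs and additive maps *)

Definition par (z : int) : bool := odd `|z|%N.

Lemma parD x y : par (x + y) = par x (+) par y.
Proof. by rewrite /par; lia. Qed.

Lemma parM x y : par (x * y) = par x && par y.
Proof. by rewrite /par abszM oddM. Qed.

(** Signs are carried by booleans instead of integer powers of -1: a Koszul sign identity becomes an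
    identity between exclusive ors of parities, settled by case analysis. *)
Definition sg {V : zmodType} (b : bool) (x : V) : V := if b then - x else x.

Section Signs.
Context {V : zmodType}.
Implicit Types (b c : bool) (x y : V).

Lemma mulrz_koszul x z : x *~ koszul z = sg (par z) x.
Proof.
have -> : koszul z = (-1) ^+ par z.
  rewrite /koszul /par; case: z => p; first exact: esym (signr_odd _ p).
  by rewrite NegzE -exprnN -exprVn invrN invr1; exact: esym (signr_odd _ p.+1).
by case: (par z); rewrite /sg ?expr1 ?expr0 ?mulrNz mulr1z.
Qed.

Lemma sgD b x y : sg b (x + y) = sg b x + sg b y.
Proof. by case: b; rewrite //= opprD. Qed.

Lemma sgN b x : sg b (- x) = - sg b x.
Proof. by case: b. Qed.

Lemma sg0 b : sg b 0 = 0 :> V.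
Proof. by case: b; rewrite /= ?oppr0. Qed.

Lemma sg_sg b c x : sg b (sg c x) = sg (b (+) c) x.
Proof. by case: b; case: c; rewrite //= opprK. Qed.

Lemma sgK b x : sg b (sg b x) = x.
Proof. by rewrite sg_sg addbb. Qed.

Lemma sg_sum b (I : Type) (r : seq I) (F : I -> V) :
  sg b (\sum_(i <- r) F i) = \sum_(i <- r) sg b (F i).
Proof. by case: b; rewrite //= sumrN. Qed.

End Signs.

Lemma sgZ {S : pzRingType} {V : lmodType S} b (a : S) (x : V) :
  sg b (a *: x) = a *: sg b x.
Proof. by case: b; rewrite //= scalerN. Qed.

Lemma sg_mull {S : pzRingType} b (x y : S) : sg b x * y = sg b (x * y).
Proof. by case: b; rewrite //= mulNr. Qed.

Lemma sg_mulr {S : pzRingType} b (x y : S) : x * sg b y = sg b (x * y).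
Proof. by case: b; rewrite //= mulrN. Qed.

Section AdditiveMaps.
Context {U V : zmodType} (f : U -> V).
Hypothesis fD : {morph f : x y / x + y}.

Lemma morph0 : f 0 = 0.
Proof. by apply: (addIr (f 0)); rewrite -fD !add0r. Qed.

Lemma morphN x : f (- x) = - f x.
Proof. by apply: (addIr (f x)); rewrite -fD !addNr morph0. Qed.

Lemma morph_sg b x : f (sg b x) = sg b (f x).
Proof. by case: b; rewrite //= morphN. Qed.

Lemma morph_sum (I : Type) (r : seq I) (F : I -> U) :
  f (\sum_(i <- r) F i) = \sum_(i <- r) f (F i).
Proof. exact: (big_morph f fD morph0). Qed.

End AdditiveMaps.

(** Prepending at [ord0] matches [big_ord_recl], which splits off the first factor of a product;
    inductions on the number of factors rest on this. *)
Definition fcons {T : Type} {p : nat} (x : T) (y : 'I_p -> T) : 'I_p.+1 -> T :=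
  fun i => if unlift ord0 i is Some j then y j else x.

Lemma fcons0 T p (x : T) (y : 'I_p -> T) : fcons x y ord0 = x.
Proof. by rewrite /fcons unlift_none. Qed.

Lemma fconsS T p (x : T) (y : 'I_p -> T) j : fcons x y (lift ord0 j) = y j.
Proof. by rewrite /fcons liftK. Qed.

(** * Homogeneous elements of the exterior algebra and graded commutativity *)

Section Homogeneous.
Context {R : realType} {n : nat} {M : smooth_manifold R n}.
Context {V : lmodType (Cinf M)} (E : exterior_algebra V).
Implicit Types (P Q T : E) (f : Cinf M) (X Y : V).

Local Notation iota := (Defs.inj E).

Lemma alg_mull f P : f%:A * P = f *: P.
Proof. exact: mulr_algl. Qed.

Lemma alg_mulr f P : P * f%:A = f *: P.
Proof. exact: mulr_algr. Qed.

Lemma ext_power0 p : ext_power iota p 0.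
Proof. by exists 0%N, (fun=> 0), (fun _ _ => 0); rewrite big_ord0. Qed.

Lemma ext_powerD p P Q :
  ext_power iota p P -> ext_power iota p Q -> ext_power iota p (P + Q).
Proof.
case=> m1 [c1 [X1 ->]] [m2 [c2 [X2 ->]]].
exists (m1 + m2)%N,
  (fun k : 'I_(m1 + m2) =>
     match fintype.split k with inl i => c1 i | inr i => c2 i end),
  (fun k : 'I_(m1 + m2) =>
     match fintype.split k with inl i => X1 i | inr i => X2 i end).
rewrite big_split_ord /=; congr (_ + _); apply: eq_bigr => i _.
  by rewrite (unsplitK (inl i)).
by rewrite (unsplitK (inr i)).
Qed.

Lemma ext_powerZ p f P : ext_power iota p P -> ext_power iota p (f *: P).
Proof.
case=> m [c [X ->]]; exists m, (fun k => f * c k), X.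
by rewrite scaler_sumr; apply: eq_bigr => k _; rewrite scalerA.
Qed.

Lemma ext_power_alg f : ext_power iota 0 (f%:A : E).
Proof.
by exists 1%N, (fun=> f), (fun _ _ => 0); rewrite big_ord1 big_ord0.
Qed.

Lemma ext_power_cons p X P :
  ext_power iota p P -> ext_power iota p.+1 (iota X * P).
Proof.
case=> m [c [Y ->]].
exists m, c, (fun k => fcons X (Y k)).
rewrite mulr_sumr; apply: eq_bigr => k _.
rewrite big_ord_recl fcons0 -scalerAr; congr (_ *: (_ * _)).
by apply: eq_bigr => i _; rewrite fconsS.
Qed.

Lemma ext_power_inj X : ext_power iota 1 (iota X).
Proof.
by rewrite -[iota X]mulr1; apply: ext_power_cons; rewrite -(scale1r 1);
   exact: ext_power_alg.
Qed.

Lemma ext_power_wedge p (X : 'I_p -> V) : ext_power iota p (wedge E X).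
Proof.
by exists 1%N, (fun=> 1), (fun=> X); rewrite big_ord1 scale1r.
Qed.

Lemma wedge_fcons p X (Y : 'I_p -> V) :
  wedge E (fcons X Y) = iota X * wedge E Y.
Proof.
rewrite /wedge big_ord_recl fcons0; congr (_ * _).
by apply: eq_bigr => i _; rewrite fconsS.
Qed.

Lemma wedge1 X : wedge E (fun _ : 'I_1 => X) = iota X.
Proof. exact: big_ord1. Qed.

Lemma wedge_omit0 p X (Y : 'I_p -> V) :
  wedge_omit E (fcons X Y) ord0 = wedge E Y.
Proof.
rewrite /wedge_omit big_mkcond big_ord_recl /= mul1r.
by apply: eq_bigr => i _; rewrite fconsS.
Qed.

Lemma wedge_omitS p X (Y : 'I_p -> V) j :
  wedge_omit E (fcons X Y) (lift ord0 j) = iota X * wedge_omit E Y j.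
Proof.
rewrite /wedge_omit big_mkcond big_ord_recl /= fcons0; congr (_ * _).
rewrite [RHS]big_mkcond; apply: eq_bigr => i _; rewrite fconsS.
by rewrite (inj_eq lift_inj).
Qed.

Lemma ext_power_wedge_omit p (X : 'I_p -> V) j :
  ext_power iota p.-1 (wedge_omit E X j).
Proof.
have H (r : seq 'I_p) : ext_power iota (size r) (\prod_(i <- r) iota (X i)).
  elim: r => [|i r IH]; last by rewrite big_cons; exact: ext_power_cons.
  by rewrite big_nil -(scale1r 1); exact: ext_power_alg.
rewrite /wedge_omit -big_filter; move: (H [seq i <- index_enum 'I_p | i != j]).
suff -> : size [seq i <- index_enum 'I_p | i != j] = p.-1 by [].
by rewrite -[in RHS](card_ord p) -(cardC1 j) cardE /enum_mem /index_enum unlock.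
Qed.

(* A scalar coefficient is absorbed by the first factor of a product of
   positive length. *)
Lemma ext_power_wedge_ind (K : nat -> E -> Prop) :
  (forall p, K p 0) ->
  (forall p P Q, K p P -> K p Q -> K p (P + Q)) ->
  (forall f, K 0%N f%:A) ->
  (forall p (X : 'I_p.+1 -> V), K p.+1 (wedge E X)) ->
  forall p P, ext_power iota p P -> K p P.
Proof.
move=> K0 KD Kf KX p P [m [c [X ->]]].
apply: big_ind => [|Q T|k _]; [exact: K0|exact: KD|].
case: p X => [|p] X; first by rewrite big_ord0; exact: Kf.
rewrite big_ord_recl scalerAl -linearZ /=.
by rewrite -wedge_fcons; exact: KX.
Qed.

(** A product of sections is built from the function 1 by multiplying on the left by one section at
    a time, so an additive property has to be checked only on functions and under such a
    multiplication. *)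
Lemma ext_power_ind (K : nat -> E -> Prop) :
  (forall p, K p 0) ->
  (forall p P Q, K p P -> K p Q -> K p (P + Q)) ->
  (forall f, K 0%N f%:A) ->
  (forall p X P, ext_power iota p P -> K p P -> K p.+1 (iota X * P)) ->
  forall p P, ext_power iota p P -> K p P.
Proof.
move=> K0 KD Kf KX; apply: ext_power_wedge_ind => // p X.
suff H q (Y : 'I_q -> V) : K q (wedge E Y) by exact: H.
elim: q Y => [|q IH] Y.
  by rewrite /wedge big_ord0 -(scale1r 1); exact: Kf.
rewrite /wedge big_ord_recl; apply: KX; first exact: ext_power_wedge.
exact: IH.
Qed.

Lemma ext_powerM p q P Q :
  ext_power iota p P -> ext_power iota q Q -> ext_power iota (p + q) (P * Q).
Proof.
move=> hP hQ; move: p P hP; apply: ext_power_ind => [p|p P T|f|p X P _ IH].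
- by rewrite mul0r; exact: ext_power0.
- by move=> ? ?; rewrite mulrDl; exact: ext_powerD.
- by rewrite alg_mull; exact: ext_powerZ.
- by rewrite -mulrA addSn; exact: ext_power_cons.
Qed.

(** Polarization of the square-zero relation at [X + Y]. *)
Lemma inj_anticomm X Y : iota X * iota Y = - (iota Y * iota X).
Proof.
have := inj_square E (X + Y); rewrite linearD mulrDl !mulrDr !inj_square.
by rewrite add0r addr0 => /eqP; rewrite addr_eq0 => /eqP.
Qed.

Lemma inj_comm q X Q :
  ext_power iota q Q -> iota X * Q = sg (odd q) (Q * iota X).
Proof.
move: q Q; apply: ext_power_ind => [q|q Q T|f|q Y Q _ IH].
- by rewrite mulr0 mul0r sg0.
- by move=> h1 h2; rewrite mulrDr mulrDl sgD h1 h2.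
- by rewrite alg_mull alg_mulr.
- rewrite mulrA inj_anticomm mulNr -!mulrA IH sg_mulr /=.
  by case: (odd q); rewrite //= opprK.
Qed.

Lemma ext_comm p q P Q : ext_power iota p P -> ext_power iota q Q ->
  P * Q = sg (odd p && odd q) (Q * P).
Proof.
move=> hP hQ; move: p P hP; apply: ext_power_ind => [p|p P T|f|p X P _ IH].
- by rewrite mulr0 mul0r sg0.
- by move=> h1 h2; rewrite mulrDr mulrDl sgD h1 h2.
- by rewrite alg_mull alg_mulr.
- rewrite -mulrA IH sg_mulr !mulrA (inj_comm X hQ) sg_mull sg_sg.
  by congr sg => /=; case: (odd p); case: (odd q).
Qed.

(** Exterior degree extended to all integers, with only 0 in negative degrees, so that maps of
    negative degree need no truncated subtraction. [homog (d + 2)] unfolds to [shifted_degree d]. *)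
Definition homog (z : int) (P : E) : Prop :=
  if z is Posz p then ext_power iota p P else P = 0.

Lemma homog0 z : homog z 0.
Proof. by case: z => // p; exact: ext_power0. Qed.

Lemma homogD z P Q : homog z P -> homog z Q -> homog z (P + Q).
Proof.
by case: z => p; [exact: ext_powerD|move=> -> ->; rewrite addr0].
Qed.

Lemma homogZ z f P : homog z P -> homog z (f *: P).
Proof. by case: z => p; [exact: ext_powerZ|move=> ->; exact: scaler0]. Qed.

Lemma homog_sg z b P : homog z P -> homog z (sg b P).
Proof.
by case: b => //= h; rewrite -scaleN1r; exact: homogZ.
Qed.

Lemma homog_sum z (I : Type) (r : seq I) (F : I -> E) :
  (forall i, homog z (F i)) -> homog z (\sum_(i <- r) F i).
Proof.
by move=> h; elim/big_ind: _ => [|P Q|i _]; [exact: homog0|exact: homogD|].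
Qed.

Lemma homog_alg f : homog 0 f%:A.
Proof. exact: ext_power_alg. Qed.

Lemma homog_inj X : homog 1 (iota X).
Proof. exact: ext_power_inj. Qed.

Lemma homogM y z P Q : homog y P -> homog z Q -> homog (y + z) (P * Q).
Proof.
case: y z => [p|p] [q|q] hP hQ; first exact: ext_powerM.
- by rewrite hQ mulr0; exact: homog0.
- by rewrite hP mul0r; exact: homog0.
- by rewrite hP mul0r; exact: homog0.
Qed.

Lemma homog_ind (K : int -> E -> Prop) :
  (forall z, K z 0) ->
  (forall z P Q, K z P -> K z Q -> K z (P + Q)) ->
  (forall f, K 0 f%:A) ->
  (forall z X P, homog z P -> K z P -> K (1 + z) (iota X * P)) ->
  forall z P, homog z P -> K z P.
Proof.
move=> K0 KD Kf KX [p|p] P /=; last by move=> ->.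
move: p P; apply: ext_power_ind => // [p|p X P hP].
  exact: KD.
by move=> ?; rewrite -addn1 PoszD addrC; exact: KX.
Qed.

End Homogeneous.

(** * Graded derivations of the exterior algebra *)

Section GradedDerivations.
Context {R : realType} {n : nat} {M : smooth_manifold R n}.
Context {V : lmodType (Cinf M)} (E : exterior_algebra V).
Implicit Types (P Q T : E) (f : Cinf M) (X Y : V) (D : E -> E).

Local Notation iota := (Defs.inj E).

(** Only additivity is imposed, not linearity over functions, so that contractions with [omega] and
    Schouten brackets, which differentiate functions, are both covered. *)
Definition graded_derivation (k : int) D : Prop :=
  [/\ {morph D : P Q / P + Q},
      forall z P, homog z P -> homog (z + k) (D P) &
      forall y z P Q, homog y P -> homog z Q ->
        D (P * Q) = D P * Q + sg (par k && par y) (P * D Q)].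

(** Functions and sections generate the algebra: the degree, and the Leibniz rule for an arbitrary
    left factor, follow by adding one section at a time on the left. *)
Lemma graded_derivationI k D :
  {morph D : P Q / P + Q} ->
  (forall f, homog k (D f%:A)) ->
  (forall X, homog (1 + k) (D (iota X))) ->
  (forall f z Q, homog z Q -> D (f%:A * Q) = D f%:A * Q + f%:A * D Q) ->
  (forall X z Q, homog z Q ->
     D (iota X * Q) = D (iota X) * Q + sg (par k) (iota X * D Q)) ->
  graded_derivation k D.
Proof.
move=> DD Df DX Lf LX; have D0 := morph0 DD; split=> //.
- move=> z P; move: z P; apply: homog_ind => [z|z P Q|f|z X P hP IH].
  + by rewrite D0; exact: homog0.
  + by rewrite DD; exact: homogD.
  + by rewrite add0r.
  + rewrite (LX _ _ _ hP); apply: homogD.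
      by rewrite addrAC; exact: homogM.
    by apply: homog_sg; rewrite -addrA; apply: homogM => //; exact: homog_inj.
- move=> y z P Q hP hQ; move: y P hP; apply: homog_ind => [y|y P T|f|y X P hP IH].
  + by rewrite D0 !mul0r D0 sg0 addr0.
  + by move=> h1 h2; rewrite mulrDl !DD h1 h2 !mulrDl sgD addrACA.
  + by rewrite (Lf _ _ _ hQ) andbF.
  + rewrite -mulrA (LX _ _ _ (homogM hP hQ)) (LX _ _ _ hP) IH mulrDr sgD.
    rewrite mulrDl !mulrA -!addrA sg_mull !sg_mulr sg_sg; congr (_ + (_ + sg _ _)).
      by rewrite parD; case: (par k).
    exact: mulrA.
Qed.

Section Derivation.
Context {k : int} {D : E -> E}.
Hypothesis Dk : graded_derivation k D.

Lemma derivationD : {morph D : P Q / P + Q}. Proof. by case: Dk. Qed.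

Lemma derivation_homog z P : homog z P -> homog (z + k) (D P).
Proof. by case: Dk => _ + _; apply. Qed.

Lemma derivationM y z P Q : homog y P -> homog z Q ->
  D (P * Q) = D P * Q + sg (par k && par y) (P * D Q).
Proof. by case: Dk => _ _; apply. Qed.

Lemma derivation_eq0 : (forall f, D f%:A = 0) -> (forall X, D (iota X) = 0) ->
  forall z P, homog z P -> D P = 0.
Proof.
move=> Df DX; apply: homog_ind => [_|z P Q h1 h2|f|z X P hP IH].
- exact: morph0 derivationD.
- by rewrite derivationD h1 h2 addr0.
- exact: Df.
- by rewrite (derivationM (homog_inj E X) hP) DX IH mul0r mulr0 sg0 addr0.
Qed.

Lemma derivation_linear z f P :
  D f%:A = 0 -> homog z P -> D (f *: P) = f *: D P.
Proof.
move=> Df hP; rewrite -alg_mull (derivationM (homog_alg E f) hP) Df.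
by rewrite mul0r add0r andbF alg_mull.
Qed.

End Derivation.

Lemma graded_derivation_add k D1 D2 :
  graded_derivation k D1 -> graded_derivation k D2 ->
  graded_derivation k (fun P => D1 P + D2 P).
Proof.
move=> [D1D h1 L1] [D2D h2 L2]; split=> [P Q|z P hP|y z P Q hP hQ].
- by rewrite D1D D2D addrACA.
- by apply: homogD; auto.
- by rewrite (L1 _ _ _ _ hP hQ) (L2 _ _ _ _ hP hQ) mulrDl mulrDr sgD addrACA.
Qed.

Lemma graded_derivation_sg k b D :
  graded_derivation k D -> graded_derivation k (fun P => sg b (D P)).
Proof.
move=> [DD h L]; split=> [P Q|z P hP|y z P Q hP hQ].
- by rewrite DD sgD.
- by apply: homog_sg; auto.
- by rewrite (L _ _ _ _ hP hQ) sgD sg_mull sg_mulr !sg_sg addbC.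
Qed.

Lemma graded_derivation0 k : graded_derivation k (fun=> 0).
Proof.
split=> [P Q|z P _|y z P Q _ _]; first by rewrite addr0.
  exact: homog0.
by rewrite mul0r mulr0 sg0 addr0.
Qed.

Definition graded_commutator (k l : int) D1 D2 : E -> E :=
  fun P => D1 (D2 P) - sg (par k && par l) (D2 (D1 P)).

(** On a product, both composites produce the mixed terms [D2 P * D1 Q] and [D1 P * D2 Q]; the sign
    in the commutator makes these cancel. The terms where both maps hit the same factor form the
    Leibniz rule. *)
Lemma graded_derivation_commutator k l D1 D2 :
  graded_derivation k D1 -> graded_derivation l D2 ->
  graded_derivation (k + l) (graded_commutator k l D1 D2).
Proof.
rewrite /graded_commutator.
move=> [D1D h1 L1] [D2D h2 L2]; split=> [P Q|z P hP|y z P Q hP hQ].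
- by rewrite D2D !D1D D2D sgD opprD addrACA.
- apply: homogD; first by rewrite [k + l]addrC addrA; auto.
  by apply: (homog_sg true); apply: homog_sg; rewrite addrA; auto.
- rewrite (L1 _ _ _ _ hP hQ) (L2 _ _ _ _ hP hQ) D1D D2D.
  rewrite (morph_sg D1D) (morph_sg D2D).
  rewrite (L1 _ _ _ _ (h2 _ _ hP) hQ) (L1 _ _ _ _ hP (h2 _ _ hQ)).
  rewrite (L2 _ _ _ _ (h1 _ _ hP) hQ) (L2 _ _ _ _ hP (h1 _ _ hQ)).
  rewrite mulrBl mulrBr !sgD !sgN sg_mull sg_mulr !sg_sg !parD !opprD.
  set a := D1 (D2 P) * Q; set b := D2 P * D1 Q; set c := D1 P * D2 Q.
  set d := P * D1 (D2 Q); set a' := D2 (D1 P) * Q; set d' := P * D2 (D1 Q).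
  rewrite -!addrA; congr (_ + _).
  have -> : sg (par k && par l (+) par l && (par y (+) par k)) c =
            sg (par l && par y) c.
    by congr sg; case: (par k); case: (par l); case: (par y).
  have -> : sg (par k && (par y (+) par l)) b =
            sg (par k && par l (+) par k && par y) b.
    by congr sg; case: (par k); case: (par l); case: (par y).
  have -> : sg (par l && par y (+) par k && par y) d =
            sg ((par k (+) par l) && par y) d.
    by congr sg; case: (par k); case: (par l); case: (par y).
  have -> : sg (par k && par l (+) par k && par y (+) par l && par y) d' =
            sg ((par k (+) par l) && par y (+) par k && par l) d'.
    by congr sg; case: (par k); case: (par l); case: (par y).
  rewrite !(addrCA _ (- sg _ b)) addKr !(addrCA _ (- sg _ c)) addKr.
  exact: addrCA.
Qed.

End GradedDerivations.

(** * The extension of a 2-form: symmetry and the derivation property *)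

Section TwoForm.
Context {R : realType} {n : nat} {M : smooth_manifold R n}.
Context {A : lie_algebroid M} {E : exterior_algebra A}.
Context {omega : two_form A} {omu : E -> E -> E}.
Hypothesis omu_spec : two_form_extension omega omu.
Implicit Types (P Q T : E) (f : Cinf M) (X Y : A).

Local Notation iota := (Defs.inj E).

Lemma two_formZr f X Y : omega X (f *: Y) = f * omega X Y.
Proof. exact: (scalarZ (flat omega X)). Qed.

Lemma two_formZl f X Y : omega (f *: X) Y = f * omega X Y.
Proof. by rewrite two_formC two_formZr -mulrN -two_formC. Qed.

Lemma omuDr P : {morph omu P : Q T / Q + T}.
Proof. by case: omu_spec. Qed.

Lemma omuDl Q : {morph omu^~ Q : P T / P + T}.
Proof. by case: omu_spec. Qed.

Lemma omu_algl f P : omu f%:A P = 0.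
Proof. by case: omu_spec => _ _ + _ => /(_ f P)[]. Qed.

Lemma omu_algr f P : omu P f%:A = 0.
Proof. by case: omu_spec => _ _ + _ => /(_ f P)[]. Qed.

Lemma omu_wedge p q (X : 'I_p -> A) (Y : 'I_q -> A) :
  omu (wedge E X) (wedge E Y) =
    \sum_(i < p) \sum_(j < q) sg (odd p (+) odd i (+) odd j)
      (omega (X i) (Y j) *: (wedge_omit E X i * wedge_omit E Y j)).
Proof.
case: omu_spec => _ _ _ ->; apply: eq_bigr => i _; apply: eq_bigr => j _.
(* Counting both indices from 0 instead of 1 changes the exponent by 2, hence not its parity. *)
rewrite mulrz_koszul !parD; congr sg; rewrite /par /=.
by case: (odd p); case: (odd i); case: (odd j).
Qed.

Lemma omu_wedge_inj p (X : 'I_p -> A) Y :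
  omu (wedge E X) (iota Y) =
    \sum_(i < p) sg (odd p (+) odd i) (omega (X i) Y *: wedge_omit E X i).
Proof.
rewrite -wedge1 omu_wedge; apply: eq_bigr => i _.
rewrite big_ord1 addbF /wedge_omit.
by rewrite [\prod_(i0 < 1 | _) _]big_mkcond big_ord1 mulr1.
Qed.

Lemma omu_inj_inj X Y : omu (iota X) (iota Y) = - (omega X Y)%:A.
Proof.
rewrite -[in LHS]wedge1 omu_wedge_inj big_ord1 /=.
by rewrite /wedge_omit big_mkcond big_ord1.
Qed.

(** On products of [p] and [q] sections, exchanging the arguments costs one sign from the
    antisymmetry of [omega], the sign [(p-1)(q-1)] from commuting the two products with an omitted
    factor, and [p + q] from the explicit signs. The total has the parity of [pq]. *)
Lemma omu_comm y z P Q : homog y P -> homog z Q ->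
  omu P Q = sg (par y && par z) (omu Q P).
Proof.
case: y => p; last by move=> -> _; rewrite (morph0 (omuDl Q)) (morph0 (omuDr Q)) sg0.
case: z => q; last first.
  by move=> _ ->; rewrite (morph0 (omuDl P)) (morph0 (omuDr P)) sg0.
move=> hP; move: q Q; apply: ext_power_wedge_ind => [q|q Q T h1 h2|f|q Y].
- by rewrite (morph0 (omuDl P)) (morph0 (omuDr P)) sg0.
- by rewrite omuDl omuDr sgD h1 h2.
- by rewrite omu_algl omu_algr sg0.
move: p P hP; apply: ext_power_wedge_ind => [p|p P T h1 h2|f|p X].
- by rewrite (morph0 (omuDl _)) (morph0 (omuDr _)) sg0.
- by rewrite omuDl omuDr sgD h1 h2.
- by rewrite omu_algl omu_algr sg0.
rewrite !omu_wedge exchange_big sg_sum; apply: eq_bigr => j _.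
rewrite sg_sum; apply: eq_bigr => i _; rewrite two_formC scaleNr.
rewrite (ext_comm (ext_power_wedge_omit E X i) (ext_power_wedge_omit E Y j)).
rewrite -sgZ sgN !sg_sg -[- sg _ _]/(sg true _) sg_sg; congr sg.
by rewrite /par /=; case: (odd p); case: (odd q); case: (odd i); case: (odd j).
Qed.

(** In the double sum, the terms pairing with the new factor [Y] give the first summand. In the
    others [Y] survives and has to be moved to the front past the [p - 1] remaining factors of
    [X]. *)
Lemma omu_wedge_cons p (X : 'I_p -> A) Y q T : ext_power iota q T ->
  omu (wedge E X) (iota Y * T) =
    omu (wedge E X) (iota Y) * T + sg (odd p) (iota Y * omu (wedge E X) T).
Proof.
move: q T; apply: ext_power_wedge_ind => [q|q T U h1 h2|f|q Z].
- by rewrite !mulr0 !(morph0 (omuDr _)) mulr0 sg0 addr0.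
- by rewrite !mulrDr !omuDr mulrDr sgD h1 h2 addrACA.
- rewrite !alg_mulr omu_algr mulr0 sg0 addr0 -linearZ !omu_wedge_inj scaler_sumr.
  by apply: eq_bigr => i _; rewrite two_formZr -scalerA sgZ.
rewrite -wedge_fcons !omu_wedge omu_wedge_inj mulr_suml mulr_sumr sg_sum.
rewrite -big_split /=; apply: eq_bigr => i _.
rewrite big_ord_recl fcons0 wedge_omit0 addbF sg_mull -scalerAl; congr (_ + _).
rewrite mulr_sumr sg_sum; apply: eq_bigr => j _.
rewrite fconsS wedge_omitS sg_mulr sg_sg -scalerAr mulrA.
rewrite [wedge_omit E X i * _](ext_comm (ext_power_wedge_omit E X i) (ext_power_inj E Y)).
rewrite sg_mull -mulrA -sgZ sg_sg; congr sg.
(* The sign of that move involves the predecessor of [p], so [p] is exposed as a successor; the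
   index [i] excludes [p = 0]. *)
case: p X i => [|p] X i; first by case: i.
rewrite /= add0n. by case: (odd p); case: (odd i); case: (odd j).
Qed.

(** Additivity in [P] reduces to a product of sections, where the Leibniz rule over a section is
    [omu_wedge_cons]. What remains is the rule over a function, which is linearity because functions
    are killed. *)
Lemma omu_derivation y P : homog y P -> graded_derivation (y - 2) (omu P).
Proof.
case: y => p; last first.
  move=> ->; have -> : omu 0 = fun=> 0.
    by apply/funext => Q; exact: morph0 (omuDl Q).
  exact: graded_derivation0.
move: p P; apply: ext_power_wedge_ind => [p|p P Q h1 h2|f|p X].
- have -> : omu 0 = fun=> 0.
    by apply/funext => Q; exact: morph0 (omuDl Q).
  exact: graded_derivation0.
- have -> : omu (P + Q) = fun T => omu P T + omu Q T.
    by apply/funext => T; exact: omuDl.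
  exact: graded_derivation_add.
- have -> : omu f%:A = fun=> 0 by apply/funext => Q; exact: omu_algl.
  exact: graded_derivation0.
apply: graded_derivationI => [|f|Y|f z Q|Y z Q].
- exact: omuDr.
- by rewrite omu_algr; exact: homog0.
- rewrite omu_wedge_inj; apply: homog_sum => i; apply: homog_sg; apply: homogZ.
  have -> : 1 + (p.+1%:Z - 2) = p%:Z by lia.
  exact: (ext_power_wedge_omit E X i).
(* The specification gives additivity and values on products of sections, so linearity over
   functions is obtained by absorbing the scalar into the first section of the second argument. *)
- rewrite omu_algr mul0r add0r; move: z Q; apply: homog_ind => [z|z P Q|g|z Y P hP _].
  + by rewrite mulr0 (morph0 (omuDr _)) mulr0.
  + by rewrite mulrDr !omuDr mulrDr => -> ->.
  + by rewrite alg_mull scalerA !omu_algr mulr0.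
  + case: z hP => q hP; last first.
      by rewrite hP !mulr0 (morph0 (omuDr _)) mulr0.
    rewrite !alg_mull scalerAl -linearZ !(omu_wedge_cons _ _ hP) linearZ.
    rewrite scalerDr -!scalerAl sgZ; congr (_ + _).
    rewrite scalerAl; congr (_ * _); rewrite -linearZ !omu_wedge_inj scaler_sumr.
    by apply: eq_bigr => i _; rewrite two_formZr -scalerA sgZ.
- have -> : par (p.+1%:Z - 2) = odd p.+1 by rewrite parD addbF.
  case: z => q; first exact: omu_wedge_cons.
  by move=> ->; rewrite !mulr0 (morph0 (omuDr _)) mulr0 sg0 addr0.
Qed.

End TwoForm.

(** * Contraction with the bivector and the derivation extending [N] *)

Section Bivector.
Context {R : realType} {n : nat} {M : smooth_manifold R n}.
Context {A : lie_algebroid M} {E : exterior_algebra A}.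
Context {bv : E} {omega : two_form A} {omu : E -> E -> E}.
Context {bform : {scalar A} -> {scalar A} -> Cinf M}.
Context {sharp : {scalar A} -> A} {Nu : E -> E}.
Hypotheses (omu_spec : two_form_extension omega omu)
  (bv2 : ext_power (Defs.inj E) 2 bv)
  (bformE : bivector_as_form bv bform)
  (sharpE : forall alpha beta : {scalar A}, beta (sharp alpha) = bform alpha beta)
  (Nu_spec : derivation_extension (sharp \o flat omega) Nu).
Implicit Types (P Q T : E) (f : Cinf M) (X Y : A).

Local Notation iota := (Defs.inj E).
Local Notation N := (sharp \o flat omega).

(** The coordinates of a section in a dual basis of the projective module are themselves linear
    forms. *)
Lemma dual_separates X Y : (forall beta : {scalar A}, beta X = beta Y) -> X = Y.
Proof.
have [m [e [e' eE]]] := sections_projective A.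
by move=> XY; rewrite (eE X) (eE Y); apply: eq_bigr => k _; rewrite XY.
Qed.

(** Write [bv] as a sum of products [U k] times [W k]. Since [bv] is even, the arguments of [omu]
    may be exchanged without sign, and contraction with [X] acts on each product as an odd
    derivation. The result is compared with [N X] expanded in the same sections. *)
Lemma omu_bivector_inj X : omu bv (iota X) = - iota (N X).
Proof.
have [m [U [W [bvE formE]]]] := bformE.
have -> : N X = \sum_(k < m) (omega X (U k) *: W k - omega X (W k) *: U k).
  apply: dual_separates => beta; rewrite sharpE formE raddf_sum.
  by apply: eq_bigr => k _; rewrite raddfB /= !scalarZ.
rewrite (omu_comm omu_spec (_ : homog 2 bv) (homog_inj E X)) //=.
rewrite bvE (morph_sum (omuDr omu_spec _)) raddf_sum /= -sumrN.
apply: eq_bigr => k _.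
rewrite (derivationM (omu_derivation omu_spec (homog_inj E X))
  (homog_inj E _) (homog_inj E _)).
rewrite !(omu_inj_inj omu_spec) /= [iota (_ - _)]linearB.
rewrite ![iota (_ *: _)]linearZ mulNr mulrN opprK.
by rewrite alg_mull alg_mulr opprB addrC.
Qed.

Lemma derivation_extensionM X z P : homog z P ->
  Nu (iota X * P) = iota (N X) * P + iota X * Nu P.
Proof.
have [NuD Nuf Nuw] := Nu_spec; have Nu0 := morph0 NuD.
have NuX Y : Nu (iota Y) = iota (N Y).
  rewrite -!wedge1 Nuw big_ord1; congr (wedge _ _).
  by apply/funext => i; rewrite (ord1 i) eqxx.
case: z => [q|q ->]; last by rewrite !mulr0 Nu0 mulr0 addr0.
move: q P; apply: ext_power_wedge_ind => [q|q P Q h1 h2|f|q Y].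
- by rewrite !mulr0 Nu0 mulr0 addr0.
- by rewrite !mulrDr !NuD mulrDr h1 h2 addrACA.
(* [sharp] is known through its pairing with linear forms, so [N (f *: X) = f *: N X] is read off
   after pairing with an arbitrary [beta]. *)
- rewrite !alg_mulr -linearZ NuX Nuf mulr0 addr0 -linearZ; congr (iota _).
  apply: dual_separates => beta; rewrite /= scalarZ !sharpE.
  have [m [U [W [_ formE]]]] := bformE; rewrite !formE mulr_sumr.
  apply: eq_bigr => k _; rewrite mulrBr !mulrA /= /flat_fun.
  by rewrite !two_formZl.
rewrite -wedge_fcons !Nuw big_ord_recl mulr_sumr -wedge_fcons; congr (_ + _).
  congr (wedge _ _); apply/funext => i; rewrite /fcons.
  by case: unliftP => [j ->|->]; rewrite ?eqxx.
apply: eq_bigr => i _; rewrite -wedge_fcons; congr (wedge _ _); apply/funext => j.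
case: (unliftP ord0 j) => [k ->|->]; last by rewrite !fcons0.
by rewrite !fconsS (inj_eq lift_inj).
Qed.

Lemma omu_bivector z P : homog z P -> omu bv P = - Nu P.
Proof.
have [NuD Nuf _] := Nu_spec.
move: z P; apply: homog_ind => [z|z P Q h1 h2|f|z X P hP IH].
- by rewrite (morph0 (omuDr omu_spec _)) (morph0 NuD) oppr0.
- by rewrite (omuDr omu_spec) NuD opprD h1 h2.
- by rewrite (omu_algr omu_spec) Nuf oppr0.
rewrite (derivationM (omu_derivation omu_spec (_ : homog 2 bv)) (homog_inj E X) hP) //=.
by rewrite omu_bivector_inj IH (derivation_extensionM X hP) opprD mulNr mulrN.
Qed.

End Bivector.

(** * The Schouten-Nijenhuis bracket as a graded derivation *)

Section Schouten.
Context {R : realType} {n : nat} {M : smooth_manifold R n}.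
Context {A : lie_algebroid M} {E : exterior_algebra A} {SN : E -> E -> E}.
Hypothesis SN_spec : schouten_nijenhuis SN.
Implicit Types (P Q T : E) (f g : Cinf M) (X Y : A).

Local Notation iota := (Defs.inj E).

Lemma Cinf_cst1 : Cinf_cst M 1 = 1.
Proof. exact: val_inj. Qed.

Lemma SN_DR P : {morph SN P : Q T / Q + T}.
Proof.
case: SN_spec => + _ Q T => /(_ 1 P Q T).
by rewrite Cinf_cst1 !scale1r.
Qed.

Lemma SN_DL Q : {morph SN^~ Q : P T / P + T}.
Proof.
case: SN_spec => _ [+ _] P T => /(_ 1 P T Q).
by rewrite Cinf_cst1 !scale1r.
Qed.

Lemma SN0r P : SN P 0 = 0. Proof. exact: morph0 (SN_DR P). Qed.

Lemma SN0l P : SN 0 P = 0. Proof. exact: morph0 (SN_DL P). Qed.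

Lemma SN_inj_alg X f : SN (iota X) f%:A = (anchor X f)%:A.
Proof. by case: SN_spec => _ [_ []]. Qed.

Lemma SN_inj_inj X Y : SN (iota X) (iota Y) = iota (bracket X Y).
Proof. by case: SN_spec => _ [_ []]. Qed.

Lemma SN_alg_alg f g : SN f%:A g%:A = 0.
Proof. by case: SN_spec => _ [_ []]. Qed.

Lemma SN_anticomm y z P Q : homog y P -> homog z Q ->
  SN P Q = - sg (par (y - 1) && par (z - 1)) (SN Q P).
Proof.
case: y => p; last by move=> -> _; rewrite SN0l SN0r sg0 oppr0.
case: z => q; last by move=> _ ->; rewrite SN0l SN0r sg0 oppr0.
case: SN_spec => _ [_ [_ _ _ + _]] hP hQ => /(_ p q P Q hP hQ) ->.
by rewrite mulrz_koszul parM.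
Qed.

Lemma SN_alg_inj f X : SN f%:A (iota X) = - (anchor X f)%:A.
Proof.
by rewrite (SN_anticomm (homog_alg E f) (homog_inj E X)) /= SN_inj_alg.
Qed.

Lemma SN_leibniz y z P Q T : homog y P -> homog z Q ->
  SN P (Q * T) = SN P Q * T + sg (par (y - 1) && par z) (Q * SN P T).
Proof.
case: y => p; last by move=> -> _; rewrite !SN0l mul0r mulr0 sg0 addr0.
case: z => q; last by move=> _ ->; rewrite mul0r SN0r !mul0r sg0 addr0.
case: SN_spec => _ [_ [_ _ _ _ +]] hP hQ => /(_ p q P Q T hP hQ) ->.
by rewrite mulrz_koszul parM.
Qed.

(** The Leibniz rule is given; the degree is not and is bootstrapped. For [P] a function or a
    section it follows from the prescribed values on generators. For general [P], antisymmetry turns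
    the bracket with a generator into a derivation already treated, applied to [P]. *)
Lemma SN_derivation y P : homog y P -> graded_derivation (y - 1) (SN P).
Proof.
have step z Q : homog z Q -> (forall f, homog (z - 1) (SN Q f%:A)) ->
    (forall X, homog z (SN Q (iota X))) -> graded_derivation (z - 1) (SN Q).
  move=> hQ Qf QX; apply: graded_derivationI => //.
  - exact: SN_DR.
  - by move=> X; rewrite addrC subrK.
  - by move=> f x T hT; rewrite (SN_leibniz _ hQ (homog_alg E f)) andbF.
  - by move=> X x T hT; rewrite (SN_leibniz _ hQ (homog_inj E X)) andbT.
have alg_der f : graded_derivation (0 - 1) (SN f%:A).
  apply: step => [|g|X]; first exact: homog_alg.
    by rewrite SN_alg_alg; exact: homog0.
  by rewrite SN_alg_inj; apply: (homog_sg true); exact: homog_alg.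
have inj_der X : graded_derivation (1 - 1) (SN (iota X)).
  apply: step => [|g|Y]; first exact: homog_inj.
    by rewrite SN_inj_alg; exact: homog_alg.
  by rewrite SN_inj_inj; exact: homog_inj.
move=> hP; apply: step => // [f|X].
  rewrite (SN_anticomm hP (homog_alg E f)); apply: (homog_sg true); apply: homog_sg.
  by have := derivation_homog (alg_der f) hP; rewrite sub0r.
rewrite (SN_anticomm hP (homog_inj E X)); apply: (homog_sg true); apply: homog_sg.
by have := derivation_homog (inj_der X) hP; rewrite subrr addr0.
Qed.

End Schouten.

(** * Vanishing of the bracket of [omu] with [l2] *)

Section Insert3.
Context {W : zmodType}.
Implicit Types (a b c : int * W) (K L : int * W -> int * W -> W).

(* [iota_K L] on three arguments, for binary [K] and [L]. *)
Definition insert3 (kbar : int) K L a b c : W :=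
  L (a.1 + b.1 + kbar, K a b) c
  + sg (par b.1 && par c.1) (L (a.1 + c.1 + kbar, K a c) b)
  + sg (par a.1 && (par b.1 (+) par c.1)) (L (b.1 + c.1 + kbar, K b c) a).

(** Rotation permutes the three terms; only the pairs [(a, c)] and [(b, c)] reach [K] in reversed
    order, and there its symmetry is used. *)
Lemma insert3_cyclic kbar K L a b c :
  (forall d e x, L (d, - x) e = - L (d, x) e) ->
  K a c = sg (par a.1 && par c.1) (K c a) ->
  K b c = sg (par b.1 && par c.1) (K c b) ->
  insert3 kbar K L a b c =
    sg (par c.1 && (par a.1 (+) par b.1)) (insert3 kbar K L c a b).
Proof.
move=> LN ac bc.
have Lsg d s x e : L (d, sg s x) e = sg s (L (d, x) e) by case: s => //=.
rewrite /insert3 ac bc !Lsg !sgD !sg_sg [c.1 + a.1]addrC [c.1 + b.1]addrC.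
rewrite addbb /= -addrA addrC; congr (sg _ _ + sg _ _ + _).
  by case: (par a.1); case: (par b.1); case: (par c.1).
by case: (par a.1); case: (par b.1); case: (par c.1).
Qed.

End Insert3.

Section Commutation.
Context {R : realType} {n : nat} {M : smooth_manifold R n}.
Context {A : lie_algebroid M} {E : exterior_algebra A} {SN : E -> E -> E}.
Context {omega : two_form A} {omu : E -> E -> E}.
Hypotheses (SN_spec : schouten_nijenhuis SN)
  (omu_spec : two_form_extension omega omu).
Implicit Types (P Q T : E) (f g : Cinf M) (X Y : A) (a b c : int * E).

Local Notation iota := (Defs.inj E).

Definition tagged_homog a : Prop := homog (a.1 + 2) a.2.

(** The sign is that of [l2]: the tag is [p - 2], so [p - 1] is odd exactly when the tag is even. *)
Definition mu2 a b : E := sg (~~ par a.1) (SN a.2 b.2).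

Definition om2 a b : E := omu a.2 b.2.

(** The Richardson-Nijenhuis bracket on three arguments; with degrees 0 and 1 its sign is a plain
    minus. *)
Definition om_mu a b c : E := insert3 0 om2 mu2 a b c - insert3 1 mu2 om2 a b c.

Lemma par_shift (d : int) : par (d + 2) = par d.
Proof. by rewrite parD addbF. Qed.

Lemma mu2_comm a b : tagged_homog a -> tagged_homog b ->
  mu2 a b = sg (par a.1 && par b.1) (mu2 b a).
Proof.
move=> ha hb; rewrite /mu2 (SN_anticomm SN_spec ha hb) -[- _]/(sg true _) !sg_sg.
congr sg; rewrite !parD.
by case: (par a.1); case: (par b.1).
Qed.

Lemma om2_comm a b : tagged_homog a -> tagged_homog b ->
  om2 a b = sg (par a.1 && par b.1) (om2 b a).
Proof.
by move=> ha hb; rewrite /om2 (omu_comm omu_spec ha hb) !par_shift.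
Qed.

Lemma mu2_derivation a : tagged_homog a ->
  graded_derivation (a.1 + 1) (fun Q => sg (~~ par a.1) (SN a.2 Q)).
Proof.
move=> ha; apply: graded_derivation_sg.
by have := SN_derivation SN_spec ha; rewrite -addrA.
Qed.

Lemma om2_derivation a : tagged_homog a -> graded_derivation a.1 (omu a.2).
Proof.
by move=> ha; have := omu_derivation omu_spec ha; rewrite addrK.
Qed.

Lemma mu2_homog a b : tagged_homog a -> tagged_homog b ->
  tagged_homog (a.1 + b.1 + 1, mu2 a b).
Proof.
move=> ha hb; have := derivation_homog (mu2_derivation ha) hb.
by rewrite /tagged_homog /=; congr homog; lia.
Qed.

Lemma om2_homog a b : tagged_homog a -> tagged_homog b ->
  tagged_homog (a.1 + b.1 + 0, om2 a b).
Proof.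
move=> ha hb; have := derivation_homog (om2_derivation ha) hb.
by rewrite /tagged_homog /=; congr homog; lia.
Qed.

Definition om_mu_derivation a b : E -> E := fun Q =>
  sg (~~ par (a.1 + b.1 + 0)) (SN (om2 a b) Q) + sg true (omu (mu2 a b) Q)
  + graded_commutator (a.1 + 1) b.1
      (fun Q => sg (~~ par a.1) (SN a.2 Q)) (omu b.2) Q
  + sg (par a.1 && par b.1) (graded_commutator (b.1 + 1) a.1
      (fun Q => sg (~~ par b.1) (SN b.2 Q)) (omu a.2) Q).

Lemma om_mu_derivationP a b : tagged_homog a -> tagged_homog b ->
  graded_derivation (a.1 + b.1 + 1) (om_mu_derivation a b).
Proof.
move=> ha hb; rewrite /om_mu_derivation.
apply: graded_derivation_add;
  [apply: graded_derivation_add; [apply: graded_derivation_add|]|].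
- by have := mu2_derivation (om2_homog ha hb); rewrite /= addr0.
- exact: graded_derivation_sg (om2_derivation (mu2_homog ha hb)).
- rewrite addrAC.
  exact: graded_derivation_commutator (mu2_derivation ha) (om2_derivation hb).
- apply: graded_derivation_sg; rewrite [a.1 + _]addrC addrAC.
  exact: graded_derivation_commutator (mu2_derivation hb) (om2_derivation ha).
Qed.

(** In the four terms where [c] is inside the inner form, symmetry of the outer form moves the inner
    value to its last slot. Every term is then a derivation, or a composite of two, applied to
    [c.2], and the composites pair up into commutators. *)
Lemma om_muE a b c : tagged_homog a -> tagged_homog b -> tagged_homog c ->
  om_mu a b c = om_mu_derivation a b c.2.
Proof.
move=> ha hb hc; rewrite /om_mu /insert3.
rewrite (mu2_comm (om2_homog ha hc) hb) (mu2_comm (om2_homog hb hc) ha).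
rewrite (om2_comm (mu2_homog ha hc) hb) (om2_comm (mu2_homog hb hc) ha).
rewrite /om_mu_derivation /graded_commutator /mu2 /om2 /= sgD sgN !sg_sg !parD !opprD.
rewrite !addrA [LHS](ACl (1*4*3*5*2*6)%AC).
congr (_ + _ + sg _ _ - sg _ _ + sg _ _ - sg _ _).
all: by case: (par a.1); case: (par b.1); case: (par c.1).
Qed.

Lemma om_mu_cyclic a b c : tagged_homog a -> tagged_homog b -> tagged_homog c ->
  om_mu a b c = sg (par c.1 && (par a.1 (+) par b.1)) (om_mu c a b).
Proof.
move=> ha hb hc; rewrite /om_mu sgD sgN; congr (_ - _).
  apply: insert3_cyclic; [|exact: om2_comm|exact: om2_comm].
  by move=> d e x; rewrite /mu2 /= (morphN (SN_DL SN_spec _)) sgN.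
apply: insert3_cyclic; [|exact: mu2_comm|exact: mu2_comm].
by move=> d e x; rewrite /om2 /= (morphN (omuDl omu_spec _)).
Qed.

Inductive generator : int * E -> Prop :=
| generator_alg f : generator (-2, f%:A)
| generator_inj X : generator (-1, iota X).

Lemma generator_homog a : generator a -> tagged_homog a.
Proof. by case=> x; [exact: homog_alg|exact: homog_inj]. Qed.

Lemma om_mu_generators a b c : closed_form omega ->
  generator a -> generator b -> generator c -> om_mu a b c = 0.
Proof.
move=> domega [f|X] [g|Y] [h|Z]; rewrite /om_mu /insert3 /mu2 /om2 /=;
 rewrite ?(omu_algl omu_spec) ?(omu_algr omu_spec) ?(omu_inj_inj omu_spec).
all: rewrite ?(morphN (SN_DL SN_spec _)) ?(morphN (omuDl omu_spec _)).
all: rewrite ?(SN0l SN_spec) ?(SN_alg_alg SN_spec) ?(SN_alg_inj SN_spec).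
all: rewrite ?(SN_inj_alg SN_spec) ?(SN_inj_inj SN_spec) ?(morphN (omuDl omu_spec _)).
all: rewrite ?(omu_algl omu_spec) ?(morph0 (omuDl omu_spec _)) ?(oppr0, addr0) //.
(* Only three sections leave a nonzero expression; its coefficient is the negated
   Chevalley-Eilenberg differential of [omega] at [X], [Y], [Z]. *)
rewrite !(omu_inj_inj omu_spec) !opprK -!scaleNr -!scalerDl -scalerBl.
rewrite -[RHS](scale0r 1); congr (_ *: _).
have /(congr1 -%R) := domega X Y Z; rewrite oppr0 !opprD !opprK => <-.
by rewrite !addrA [LHS](ACl (3*2*1*4*5*6)%AC).
Qed.

Lemma om_mu_extend a b c : tagged_homog a -> tagged_homog b -> tagged_homog c ->
  (forall e, generator e -> om_mu a b e = 0) -> om_mu a b c = 0.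
Proof.
move=> ha hb hc H; rewrite om_muE //.
apply: (derivation_eq0 (om_mu_derivationP ha hb) _ _ hc) => x.
  rewrite -[_%:A]/((-2 : int, x%:A : E).2) -om_muE //; last exact: homog_alg.
  by apply: H; exact: generator_alg.
rewrite -[iota x]/((-1 : int, iota x : E).2) -om_muE //; last exact: homog_inj.
by apply: H; exact: generator_inj.
Qed.

Lemma om_mu_rotate a b c : tagged_homog a -> tagged_homog b -> tagged_homog c ->
  om_mu a b c = 0 -> om_mu c a b = 0.
Proof.
move=> ha hb hc; rewrite om_mu_cyclic //.
move=> /(congr1 (sg (par c.1 && (par a.1 (+) par b.1)))).
by rewrite sgK sg0.
Qed.

(** Starting from generators in all slots, the last slot is freed by the derivation property. A
    rotation puts a generator last again, so two further rounds free the other two slots. *)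
Lemma om_mu_eq0 a b c : closed_form omega ->
  tagged_homog a -> tagged_homog b -> tagged_homog c -> om_mu a b c = 0.
Proof.
move=> domega; have gh := generator_homog.
have H1 u v w : generator u -> generator v -> tagged_homog w -> om_mu u v w = 0.
  by move=> gu gv hw; apply: om_mu_extend; auto => e; exact: om_mu_generators.
have H2 u v w : tagged_homog u -> generator v -> tagged_homog w -> om_mu u v w = 0.
  move=> hu gv hw; apply: om_mu_extend; auto => e he.
  by apply: om_mu_rotate; auto.
move=> ha hb hc; apply: om_mu_extend => // e he.
by apply: om_mu_rotate; auto.
Qed.

End Commutation.

(** * Unshuffles with an empty block or with a last block of size one *)

(** The two lists of values are strictly sorted with the same members, hence equal. This identifies
    an unshuffle from the images of its blocks. *)
Lemma increasing_eq n (f g : 'I_n -> nat) :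
  {homo f : i j / (i < j)%N} -> {homo g : i j / (i < j)%N} ->
  (forall i, exists j, g j = f i) -> (forall i, exists j, f j = g i) -> f =1 g.
Proof.
move=> fm gm fg gf.
have srt (h : 'I_n -> nat) : {homo h : i j / (i < j)%N} ->
    sorted ltn [seq h i | i <- enum 'I_n].
  move=> hm; rewrite sorted_map.
  apply: (@sub_sorted _ (relpre val ltn)) => [i j|]; first exact: hm.
  by rewrite -sorted_map val_enum_ord iota_ltn_sorted.
have : [seq f i | i <- enum 'I_n] = [seq g i | i <- enum 'I_n].
  apply: (irr_sorted_eq ltn_trans ltnn); [exact: srt|exact: srt|move=> k].
  apply/mapP/mapP => -[i _ ->]; [have [j <-] := fg i|have [j <-] := gf i];
    by exists j; rewrite ?mem_enum.
by move=> /eq_in_map fgE i; apply: fgE; rewrite mem_enum.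
Qed.

Lemma unshufflesP m k (s : 'S_m) : reflect
  (forall i j : 'I_m, (i < j)%N -> (j < k)%N || (k <= i)%N -> (s i < s j)%N)
  (s \in unshuffles m k).
Proof.
rewrite inE; apply: (iffP forallP) => [H i j ij ijk|H i].
  by have /forallP/(_ j) := H i; rewrite ij ijk.
by apply/forallP => j; apply/implyP => /andP[]; exact: H.
Qed.

(** With one block empty, the permutation is increasing on all indices. *)
Lemma unshuffles_id m k (s : 'S_m) : (k == 0%N) || (k == m) ->
  (s \in unshuffles m k) = (s == 1%g).
Proof.
move=> km; apply/idP/eqP => [/unshufflesP H|->].
  apply/permP => i; apply: val_inj; rewrite perm1.
  apply: (increasing_eq (f := val \o s) (g := val)) => // {}i.
  - move=> j ij; apply: H => //; case/orP: km => /eqP ->; first by rewrite orbT.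
    by rewrite ltn_ord.
  - by exists (s i).
  - by exists ((s^-1)%g i); rewrite /= permKV.
by apply/unshufflesP => i j ij _; rewrite !perm1.
Qed.

Lemma big_unshuffles_id (V : zmodType) m k (F : 'S_m -> V) :
  (k == 0%N) || (k == m) -> \sum_(s in unshuffles m k) F s = F 1%g.
Proof.
move=> km; rewrite -[RHS](big_pred1_eq +%R); apply: eq_bigl => s.
exact: unshuffles_id.
Qed.

(** Once the image of the last index is fixed, both permutations enumerate its complement in
    increasing order. *)
Lemma unshuffles_last n (s : 'S_n.+1) : s \in unshuffles n.+1 n ->
  lift_perm ord_max (s ord_max) 1 = s.
Proof.
move=> /unshufflesP H; apply/permP => i; case: (unliftP ord_max i) => [j ->|->];
  last by rewrite lift_perm_id.
rewrite lift_perm_lift perm1; apply: val_inj.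
apply: (increasing_eq (f := fun j => val (lift (s ord_max) j))
  (g := fun j => val (s (lift ord_max j)))) => /= {i j}.
- by move=> i j; rewrite !ltnNge leq_bump2.
- by move=> i j ij; apply: H; rewrite !lift_max ?ltn_ord.
- move=> i; case: (unliftP ord_max ((s^-1)%g (lift (s ord_max) i))) => [k|] E.
    by exists k; rewrite -E permKV.
  have := neq_lift (s ord_max) i.
  by rewrite -[X in _ != X](permKV s) E eqxx.
- move=> i; case: (unliftP (s ord_max) (s (lift ord_max i))) => [k ->|].
    by exists k.
  by move=> /perm_inj/eqP; rewrite eq_sym (negPf (neq_lift _ _)).
Qed.

Lemma lift_perm_unshuffle n (j : 'I_n.+1) :
  lift_perm ord_max j 1%g \in unshuffles n.+1 n.
Proof.
apply/unshufflesP => i k ik ikn.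
have {ikn} kn : (k < n)%N.
  case/orP: ikn => // ni.
  by have := leq_trans (leq_ltn_trans ni ik) (ltn_ord k); rewrite ltnn.
case: (unliftP ord_max i) ik => [i' ->|->]; last by rewrite /= ltnNge ltnW.
case: (unliftP ord_max k) kn => [k' ->|->]; last by rewrite /= ltnn.
by rewrite !lift_max => _ ik; rewrite !lift_perm_lift !perm1 /= ltnNge leq_bump2 -ltnNge.
Qed.

Lemma big_unshuffles_last (V : zmodType) n (F : 'S_n.+1 -> V) :
  \sum_(s in unshuffles n.+1 n) F s = \sum_(j < n.+1) F (lift_perm ord_max j 1%g).
Proof.
rewrite (reindex_onto (fun j => lift_perm ord_max j 1%g) (fun s => s ord_max)).
  by apply: eq_bigl => j; rewrite lift_perm_unshuffle lift_perm_id eqxx.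
exact: unshuffles_last.
Qed.

(** * Insertions of forms, computed on short lists *)

Section Insertion.
Context {R : realType} {V : lmodType R}.
Implicit Types (K L : vform V) (X Y Z : seq (int * V)) (a b c : int * V) (kbar : int).

(** The fragment of linearity that discards the terms of an insertion whose inner value is 0,
    whatever its tag. *)
Definition kills0 L := forall d Z, L ((d, 0) :: Z) = 0.

Definition supported (k : nat) K := forall X, size X != k -> K X = 0.

Lemma size_permute X (s : 'S_(size X)) : size (permute s) = size X.
Proof. by rewrite size_map size_enum_ord. Qed.

Lemma mem_permute X (s : 'S_(size X)) : {subset permute s <= X}.
Proof. by move=> a /mapP[i _ ->]; exact: mem_nth. Qed.

Lemma permute1 X : permute (1%g : 'S_(size X)) = X.
Proof.
rewrite /permute -[RHS](mkseq_nth (0, 0)) /mkseq -val_enum_ord -map_comp.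
by apply: eq_map => i /=; rewrite perm1.
Qed.

Lemma koszul_sign1 X : koszul_sign (1%g : 'S_(size X)) = 1.
Proof.
rewrite /koszul_sign big1 // => i _; apply: big_pred0 => j; rewrite !perm1.
by case: ltngtP.
Qed.

Lemma insertion_supported kbar k K L X : supported k K -> kills0 L ->
  insertion kbar K L X = if (k <= size X)%N then
    \sum_(s in unshuffles (size X) k)
      L ((total_degree (take k (permute s)) + kbar, K (take k (permute s)))
           :: drop k (permute s)) *~ koszul_sign s else 0.
Proof.
move=> Kk L0; rewrite /insertion.
have E (i : 'I_(size X).+1) : val i != k -> \sum_(s in unshuffles (size X) i)
    L ((total_degree (take i (permute s)) + kbar, K (take i (permute s)))
         :: drop i (permute s)) *~ koszul_sign s = 0.
  move=> ik; rewrite big1 // => s _; rewrite [K _]Kk ?L0 ?mul0rz //.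
  by rewrite size_takel // size_permute -ltnS.
case: leqP => kX; last first.
  by rewrite big1 // => i _; apply: E; rewrite neq_ltn (leq_trans (ltn_ord i) kX).
rewrite (bigD1 (Ordinal (kX : (k < (size X).+1)%N))) //= -[RHS]addr0.
by congr (_ + _); apply: big1 => i ik; exact: E.
Qed.

(** The inner form consumes [k] arguments and its value fills one of the [l + 1] slots of [L]. *)
Lemma insertion_arity kbar k l K L X : supported k K -> supported l.+1 L ->
  kills0 L -> size X != (k + l)%N -> insertion kbar K L X = 0.
Proof.
move=> Kk Ll L0 Xkl; rewrite (insertion_supported _ _ Kk L0).
case: leqP => // kX; rewrite big1 // => s _; rewrite Ll ?mul0rz //=.
by rewrite size_drop size_permute; lia.
Qed.

Lemma insertion_zero_form kbar v L X : kills0 L ->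
  insertion kbar (zero_form v) L X = L ((kbar, v) :: X).
Proof.
move=> L0; rewrite (@insertion_supported _ 0) //=; last by case.
rewrite big_unshuffles_id ?eqxx // permute1 koszul_sign1 take0 drop0.
by rewrite /total_degree big_nil add0r.
Qed.

Lemma insertion_full kbar K L X : supported (size X) K -> kills0 L ->
  insertion kbar K L X = L [:: (total_degree X + kbar, K X)].
Proof.
move=> KX L0; rewrite (insertion_supported _ _ KX L0) leqnn.
rewrite big_unshuffles_id ?eqxx ?orbT // permute1 koszul_sign1.
by rewrite take_size drop_size.
Qed.

(** Numerical values let the permuted lists and Koszul signs reduce by computation on two or three
    arguments. *)
Lemma lift_perm_last n (j i : 'I_n.+1) :
  lift_perm ord_max j 1%g i = (if val i == n then val j else bump j i) :> nat.
Proof.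
case: (unliftP ord_max i) => [k ->|->]; last by rewrite lift_perm_id /= eqxx.
by rewrite lift_perm_lift perm1 -[\val _]/(nat_of_ord _) lift_max ltn_eqF.
Qed.

Lemma koszul_signE X (s : 'S_(size X)) : koszul_sign s =
  \prod_(i < size X) \prod_(j < size X)
    if (i < j)%N && (s j < s i)%N
    then koszul ((nth (0, 0) X (s i)).1 * (nth (0, 0) X (s j)).1) else 1.
Proof. by apply: eq_bigr => i _; exact: big_mkcond. Qed.

Lemma insertion12 kbar K L a b : supported 1 K -> kills0 L ->
  insertion kbar K L [:: a; b] =
    L [:: (a.1 + kbar, K [:: a]); b]
    + sg (par a.1 && par b.1) (L [:: (b.1 + kbar, K [:: b]); a]).
Proof.
move=> K1 L0; rewrite (insertion_supported _ _ K1 L0) /= big_unshuffles_last.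
rewrite !big_ord_recl big_ord0 !koszul_signE.
rewrite /permute /= !big_ord_recl !big_ord0 !enum_ordSl enum_ord0.
rewrite /= !lift_perm_last /=.
rewrite /total_degree !big_seq1 !mul1r !mulr1 mulr1z mulrz_koszul parM addr0 addrC.
by rewrite [par b.1 && _]andbC.
Qed.

(** The three unshuffles are indexed by the argument left outside [K], which lists the terms in the
    opposite order to [insert3]. *)
Lemma insertion23 kbar K L a b c : supported 2 K -> kills0 L ->
  insertion kbar K L [:: a; b; c] =
    insert3 kbar (fun x y => K [:: x; y]) (fun x y => L [:: x; y]) a b c.
Proof.
move=> K2 L0; rewrite (insertion_supported _ _ K2 L0) /= big_unshuffles_last.
rewrite !big_ord_recl big_ord0 !koszul_signE.
rewrite /permute /= !big_ord_recl !big_ord0 !enum_ordSl enum_ord0.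
rewrite /= !lift_perm_last /=.
rewrite /insert3 /total_degree !big_cons !big_nil !mul1r !mulr1 !addr0 !mulr1z.
rewrite mulrzA !mulrz_koszul sg_sg !parM addrC; congr (_ + sg _ _).
  by rewrite addrC [par c.1 && _]andbC.
by case: (par a.1); case: (par b.1); case: (par c.1).
Qed.

Lemma eq_insertionl kbar K K' L X : (forall Y, {subset Y <= X} -> K Y = K' Y) ->
  insertion kbar K L X = insertion kbar K' L X.
Proof.
move=> KK'; rewrite /insertion; apply: eq_bigr => k _; apply: eq_bigr => s _.
by rewrite KK' // => a /mem_take; exact: mem_permute.
Qed.

(** As [L] and [L'] agree on homogeneous lists, the degree of [K] is used to see that the list with
    the inserted value is again homogeneous. *)
Lemma eq_insertionr gr kbar K L L' X : form_eq gr L L' ->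
  homogeneous gr X ->
  (forall Y, homogeneous gr Y -> gr (total_degree Y + kbar) (K Y)) ->
  insertion kbar K L X = insertion kbar K L' X.
Proof.
move=> LL' hX hK; rewrite /insertion; apply: eq_bigr => k _; apply: eq_bigr => s _.
congr (_ *~ _); apply: LL' => a; rewrite inE.
move=> /predU1P[->|/mem_drop/mem_permute]; last exact: hX.
by apply: hK => b /mem_take/mem_permute; exact: hX.
Qed.

Lemma insertionDl kbar K K' L X :
  (forall d x y Z, L ((d, x + y) :: Z) = L ((d, x) :: Z) + L ((d, y) :: Z)) ->
  insertion kbar (fun Y => K Y + K' Y) L X =
    insertion kbar K L X + insertion kbar K' L X.
Proof.
move=> LD; rewrite /insertion -big_split; apply: eq_bigr => k _.
by rewrite -big_split; apply: eq_bigr => s _; rewrite LD mulrzDl.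
Qed.

(** The outer form always receives the inserted value, so its 0-form component never contributes. *)
Lemma eq_insertion_nonnil kbar K L L' X :
  (forall a Z, L (a :: Z) = L' (a :: Z)) ->
  insertion kbar K L X = insertion kbar K L' X.
Proof.
move=> LL'; rewrite /insertion; apply: eq_bigr => k _; apply: eq_bigr => s _.
by rewrite LL'.
Qed.

End Insertion.

(** * Degree, symmetry and real linearity of [l2] and of [omu + pi] *)

Section SymmetricForms.
Context {R : realType} {n : nat} {M : smooth_manifold R n}.
Context {A : lie_algebroid M} {E : exterior_algebra A} {SN : E -> E -> E}.
Context {omega : two_form A} {omu : E -> E -> E}.
Hypotheses (SN_spec : schouten_nijenhuis SN)
  (omu_spec : two_form_extension omega omu).

Local Notation gr := (@shifted_degree R n M A E).
Local Notation mu := (l2 SN : vform (over_reals E)).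
Local Notation om := (binary_form (omu : over_reals E -> over_reals E -> over_reals E)).

Lemma l2E (a b : int * over_reals E) : mu [:: a; b] = mu2 (SN := SN) a b.
Proof.
case: a b => [d P] [e Q]; rewrite /l2 mulrz_koszul; congr sg.
by rewrite -addrA parD addbT.
Qed.

Lemma supported_l2 : supported 2 mu.
Proof. by case=> [|[? ?] [|[? ?] [|? ?]]]. Qed.

Lemma supported_binary : supported 2 om.
Proof. by case=> [|[? ?] [|[? ?] [|? ?]]]. Qed.

Lemma supported_unary (f : over_reals E -> over_reals E) :
  supported 1 (unary_form f).
Proof. by case=> [|[? ?] [|? ?]]. Qed.

Lemma kills0_l2 : kills0 mu.
Proof.
move=> d [|[e Q] [|? ?]] //=.
by rewrite [SN _ _](SN0l SN_spec) mul0rz.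
Qed.

Lemma kills0_binary : kills0 om.
Proof. by move=> d [|[e Q] [|? ?]] //=; exact: (morph0 (omuDl omu_spec Q)). Qed.

Lemma kills0_unary (f : over_reals E -> over_reals E) :
  f 0 = 0 -> kills0 (unary_form f).
Proof. by move=> f0 d [|[e Q] ?]. Qed.

Lemma homogeneous_cons (a : int * over_reals E) s :
  homogeneous gr (a :: s) <-> gr a.1 a.2 /\ homogeneous gr s.
Proof.
split=> [h|[ha hs] b]; last by rewrite inE => /predU1P[->|/hs].
by split=> [|b bs]; apply: h; rewrite inE ?eqxx // bs orbT.
Qed.

Lemma omu_linear_r y z (f : Cinf M) (P Q T : E) : homog z Q -> homog z T ->
  homog y P -> omu P (f *: Q + T) = f *: omu P Q + omu P T.
Proof.
move=> hQ hT hP; rewrite (omuDr omu_spec).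
by rewrite (derivation_linear (omu_derivation omu_spec hP) (omu_algr omu_spec f P) hQ).
Qed.

Lemma omu_linear_l y z (f : Cinf M) (P Q T : E) : homog z Q -> homog z T ->
  homog y P -> omu (f *: Q + T) P = f *: omu Q P + omu T P.
Proof.
move=> hQ hT hP; rewrite (omu_comm omu_spec (homogD (homogZ f hQ) hT) hP).
rewrite (omu_linear_r f hQ hT hP) sgD sgZ.
by rewrite -!(omu_comm omu_spec _ hP).
Qed.

(** Only lists of length two matter; there the degree and symmetry come from [mu2], and linearity
    over the reals from the bilinearity of the Schouten bracket. *)
Lemma l2_symmetric : Defs.symmetric_form gr 1 mu.
Proof.
split.
- case=> [|a [|b [|c s]]] hs; first exact: (homog0 E).
  + by case: a hs => d P _; exact: (homog0 E).
  + have [ha /homogeneous_cons[hb _]] := (homogeneous_cons _ _).1 hs.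
    rewrite l2E /total_degree !big_cons big_nil addr0.
    exact: (mu2_homog SN_spec ha hb).
  + by case: a b hs => ? ? [? ?] _; exact: (homog0 E).
- case=> [|x [|y s]] a b t.
  + case: t => [|c t] hs; last by case: a hs => ? ? _; case: b => ? ?; rewrite /= mul0rz.
    have [ha /homogeneous_cons[hb _]] := (homogeneous_cons _ _).1 hs.
    by rewrite !cat0s !l2E mulrz_koszul parM; exact: mu2_comm.
  + by case: x => ? ?; case: a b => ? ? [? ?] _; rewrite /= mul0rz.
  + by case: x y s => ? ? [? ?] [|? ?] _; rewrite /= mul0rz.
- case=> [|x [|y s]] d r P Q t.
  + case: t => [|[e T] [|e' t]] hP hQ; rewrite /= ?scaler0 ?addr0 //.
    rewrite -scalerMzr -mulrzDl; congr (_ *~ _).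
    by case: SN_spec => _ [+ _]; exact.
  + case: t => [|e t] hP hQ; case: x hP hQ => e' T _ _;
      rewrite /= ?scaler0 ?addr0 //.
    rewrite -scalerMzr -mulrzDl; congr (_ *~ _).
    by case: SN_spec => + _; exact.
  + by case: x y s => ? ? [? ?] [|? ?] _ _; rewrite /= scaler0 addr0.
Qed.

Lemma curved_symmetric (bv : E) : ext_power (Defs.inj E) 2 bv ->
  Defs.symmetric_form gr 0 (form_with_curvature omu bv).
Proof.
rewrite /form_with_curvature => hbv; split.
- case=> [|a [|b [|c s]]] hs; rewrite /= ?addr0 ?add0r.
  (* The 0-form component must have shifted degree 0, which is exterior degree 2. *)
  + by rewrite /total_degree big_nil.
  + by case: a hs => d P _; rewrite ?addr0; exact: (homog0 E).
  + have [ha /homogeneous_cons[hb _]] := (homogeneous_cons _ _).1 hs.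
    case: a b ha hb {hs} => [d P] [e Q] ha hb; rewrite ?addr0.
    rewrite /total_degree !big_cons big_nil ?addr0.
    by have := om2_homog omu_spec (a := (d, P)) (b := (e, Q)) ha hb; rewrite ?addr0.
  + by case: a b hs => ? ? [? ?] _; rewrite ?addr0; exact: (homog0 E).
- case=> [|x [|y s]] a b t.
  + case: t => [|c t] hs; last first.
      by case: a hs => ? ? _; case: b => ? ?; rewrite /= ?addr0 mul0rz.
    have [ha /homogeneous_cons[hb _]] := (homogeneous_cons _ _).1 hs.
    case: a b ha hb {hs} => [d P] [e Q] ha hb; rewrite /= ?addr0 mulrz_koszul parM.
    exact: (om2_comm omu_spec (a := (d, P)) (b := (e, Q)) ha hb).
  + by case: x => ? ?; case: a b => ? ? [? ?] _; rewrite /= ?addr0 mul0rz.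
  + by case: x y s => ? ? [? ?] [|? ?] _; rewrite /= ?addr0 mul0rz.
- case=> [|x [|y s]] d r P Q t.
  + case: t => [|c [|e t]] /homogeneous_cons[hP ht] /homogeneous_cons[hQ _];
      rewrite /= ?scaler0 ?addr0 ?scaler0 //; last first.
      by case: c ht => ? ? _; rewrite ?addr0 scaler0.
    have [hc _] := (homogeneous_cons _ _).1 ht.
    case: c hc {ht} => [e T] hT; rewrite ?addr0.
    exact: (omu_linear_l (Cinf_cst M r) hP hQ hT).
  + case: t => [|e t] /homogeneous_cons[hx /homogeneous_cons[hP _]]
      /homogeneous_cons[_ /homogeneous_cons[hQ _]]; last first.
      by case: x hx => ? ? _; rewrite /= ?addr0 scaler0.
    case: x hx => [e T] hT; rewrite /= ?addr0.
    exact: (omu_linear_r (Cinf_cst M r) hP hQ hT).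
  + by case: x y s => ? ? [? ?] [|? ?] _ _; rewrite /= ?addr0 scaler0.
Qed.

End SymmetricForms.

(** * The deformed structure and the square *)

Section Brackets.
Context {R : realType} {n : nat} {M : smooth_manifold R n}.
Context {A : lie_algebroid M} {E : exterior_algebra A} {SN : E -> E -> E}.
Context {omega : two_form A} {omu : E -> E -> E} {bv : E} {Nu : E -> E}.
Hypotheses (SN_spec : schouten_nijenhuis SN)
  (omu_spec : two_form_extension omega omu)
  (domega : closed_form omega) (hbv : poisson SN bv)
  (NuD : {morph Nu : P Q / P + Q})
  (omu_bv : forall z P, homog z P -> omu bv P = - Nu P).

Local Notation gr := (@shifted_degree R n M A E).
Local Notation mu := (l2 SN : vform (over_reals E)).
Local Notation om := (binary_form (omu : over_reals E -> over_reals E -> over_reals E)).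
Local Notation calN := (form_with_curvature omu bv).
Local Notation NU := (unary_form (Nu : over_reals E -> over_reals E)).
Local Notation ad := (fun X => - l1 SN bv X).

(** On homogeneous elements [Nu] is the negative of [omu bv], a derivation of degree 0 killing
    functions; its degree and its linearity over functions are inherited from there. *)
Lemma Nu_symmetric : Defs.symmetric_form gr 0 NU.
Proof.
have NuZ z (f : Cinf M) P : homog z P -> Nu (f *: P) = f *: Nu P.
  move=> hP; apply: oppr_inj; rewrite -scalerN -(omu_bv hP) -(omu_bv (homogZ f hP)).
  have hbv' : homog 2 bv := hbv.1.
  exact: (derivation_linear (omu_derivation omu_spec hbv') (omu_algr omu_spec f bv) hP).
split.
- case=> [|a [|b s]] hs; first exact: (homog0 E).
  + have [ha _] := (homogeneous_cons _ _).1 hs; case: a ha {hs} => d P hP.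
    rewrite /total_degree big_cons big_nil !addr0 /=.
    rewrite -[Nu P]opprK -(omu_bv hP); apply: (homog_sg true).
    have hbv' : homog 2 bv := hbv.1.
    by have := derivation_homog (omu_derivation omu_spec hbv') hP; rewrite addr0.
  + by case: a hs => ? ? _; exact: (homog0 E).
- case=> [|x [|y s]] a b t _.
  + by case: a => ? ?; case: b => ? ?; rewrite /= mul0rz.
  + by case: x => ? ?; rewrite /= mul0rz.
  + by case: x => ? ?; rewrite /= mul0rz.
- case=> [|x [|y s]] d r P Q t; last 2 first.
  + by case: x => ? ? _ _; rewrite /= scaler0 addr0.
  + by case: x => ? ? _ _; rewrite /= scaler0 addr0.
  case: t => [|c t] /homogeneous_cons[hP _] _; last by rewrite /= scaler0 addr0.
  by rewrite /= [LHS]NuD; congr (_ + _); exact: NuZ hP.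
Qed.

Lemma mulrz_koszul0 (V : zmodType) (x : V) k : x *~ koszul (0 * k) = x.
Proof. by rewrite mul0r mulr1z. Qed.

Lemma calN_insertion kbar (L : vform (over_reals E)) X : kills0 L ->
  (forall d x y Z, L ((d, x + y) :: Z) = L ((d, x) :: Z) + L ((d, y) :: Z)) ->
  insertion kbar calN L X = insertion kbar om L X + L ((kbar, bv) :: X).
Proof. by move=> L0 LD; rewrite [LHS]insertionDl // insertion_zero_form. Qed.

Lemma insertion_calN kbar (K : vform (over_reals E)) X :
  insertion kbar K calN X = insertion kbar K om X.
Proof. by apply: eq_insertion_nonnil => a Z; rewrite /form_with_curvature /= addr0. Qed.

Lemma rn_om_mu X : homogeneous gr X ->
  insertion 0 om mu X - insertion 1 mu om X = 0.
Proof.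
have sB : supported 2 om by exact: supported_binary.
have sM : supported 2 mu by exact: supported_l2.
have kB : kills0 om by exact: (kills0_binary omu_spec).
have kM : kills0 mu by exact: kills0_l2.
move=> hX; have [s3|s3] := eqVneq (size X) 3; last first.
  rewrite (insertion_arity 0 sB sM kM s3).
  rewrite (insertion_arity 1 sM sB kB s3).
  exact: subrr.
case: X hX s3 => [|a [|b [|c [|? ?]]]] // hX _.
have [ha /homogeneous_cons[hb /homogeneous_cons[hc _]]] := (homogeneous_cons _ _).1 hX.
rewrite (insertion23 0 _ _ _ sB kM).
rewrite (insertion23 1 _ _ _ sM kB).
have := om_mu_eq0 SN_spec omu_spec domega ha hb hc; rewrite /om_mu /insert3 !l2E.
by case: a b c ha hb hc {hX} => [? ?] [? ?] [? ?].
Qed.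

Lemma deformed_bracket : form_eq gr (rn_bracket 0 1 calN mu) ad.
Proof.
move=> X hX; rewrite /rn_bracket mulrz_koszul0 insertion_calN.
rewrite calN_insertion; last 2 first.
- exact: kills0_l2.
- move=> d x y [|[e Q] [|? ?]]; rewrite /= ?addr0 // -mulrzDl.
  by congr (_ *~ _); exact: (SN_DL SN_spec).
rewrite addrAC (rn_om_mu hX) add0r.
(* What is left is [l2] with [bv] in its first slot. Its tag 0 means [p = 2], and the sign
   [(-1)^(p-1)] gives the minus. *)
case: X hX => [|[d P] [|? ?]] hX; by rewrite /= ?oppr0.
Qed.

(** The two sides are the brackets of [omu] with the deformed structure and of [Nu] with [l2],
    written out on two arguments. *)
Lemma square_bracket_identity (a b : int * E) :
  tagged_homog a -> tagged_homog b ->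
  - SN bv (omu a.2 b.2)
    - (omu (- SN bv a.2) b.2
       + sg (par a.1 && par b.1) (omu (- SN bv b.2) a.2)) =
  mu2 (SN := SN) (a.1 + 0, Nu a.2) b
    + sg (par a.1 && par b.1) (mu2 (SN := SN) (b.1 + 0, Nu b.2) a)
    - Nu (mu2 (SN := SN) a b).
Proof.
move=> ha hb; pose p : int * E := (0, bv).
have hp : tagged_homog p := hbv.1.
have := om_mu_eq0 SN_spec omu_spec domega hp ha hb; rewrite /om_mu /insert3.
(* Having even degree, [bv] moves to the first slot without sign, where [omu bv] becomes [- Nu]. *)
rewrite [mu2 _ p](mu2_comm SN_spec (om2_homog omu_spec ha hb) hp).
rewrite [om2 _ p](om2_comm omu_spec (mu2_homog SN_spec ha hb) hp) !andbF.
rewrite /om2 /= (omu_bv ha) (omu_bv hb) (omu_bv (mu2_homog SN_spec ha hb)).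
rewrite /mu2 /= !addr0 !add0r !(morphN (SN_DL SN_spec _)) !sgN => H.
apply/eqP; rewrite -subr_eq0 -[X in _ == X]H; apply/eqP.
by rewrite !opprD !opprK !addrA [LHS](ACl (4*5*1*2*3*6)%AC).
Qed.

Lemma square_bracket :
  form_eq gr (rn_bracket 0 1 calN (rn_bracket 0 1 calN mu)) (rn_bracket 0 1 NU mu).
Proof.
have symN := curved_symmetric omu_spec hbv.1.
move=> X hX; rewrite /rn_bracket -/(rn_bracket 0 1 calN mu) !mulrz_koszul0.
have [degN _ _] := symN.
rewrite (eq_insertionr deformed_bracket hX degN).
have -> : insertion 1 (rn_bracket 0 1 calN mu) calN X = insertion 1 ad calN X.
  by apply: eq_insertionl => Y YX; apply: deformed_bracket => a /YX/hX.
rewrite insertion_calN.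
have Nu0 : Nu 0 = 0 := morph0 NuD.
have sB : supported 2 om by exact: supported_binary.
have sM : supported 2 mu by exact: supported_l2.
have sN : supported 1 NU by exact: supported_unary.
have sA : supported 1 ad.
  move=> Y /(supported_unary (SN bv : over_reals E -> over_reals E)) l1Y.
  by rewrite /l1 l1Y oppr0.
have kB : kills0 om by exact: (kills0_binary omu_spec).
have kM : kills0 mu by exact: kills0_l2.
have kN : kills0 NU by exact: kills0_unary.
have kA : kills0 ad.
  move=> d Z; rewrite /l1 (kills0_unary _) ?oppr0 //; exact: (SN0r SN_spec bv).
have AD d x y Z : ad ((d, x + y) :: Z) = ad ((d, x) :: Z) + ad ((d, y) :: Z).
  by case: Z => [|? ?]; rewrite /= ?oppr0 ?addr0 // -opprD [SN _ _](SN_DR SN_spec).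
rewrite (calN_insertion _ _ kA AD).
(* The curvature term: on the empty list it is minus the bracket of [bv] with itself, zero by the
   Poisson condition; on longer lists the arity is wrong. *)
have -> : ad ((0, bv) :: X) = 0.
  by case: X {hX} => [|? ?]; rewrite /= ?oppr0 //; rewrite [SN _ _](hbv.2) oppr0.
rewrite addr0; have [s2|s2] := eqVneq (size X) 2; last first.
  rewrite (insertion_arity 0 sB sA kA s2) (insertion_arity 1 sA sB kB s2).
  by rewrite (insertion_arity 0 sN sM kM s2) (insertion_arity 1 sM sN kN s2).
case: X hX s2 => [|a [|b [|? ?]]] // hX _.
have [ha /homogeneous_cons[hb _]] := (homogeneous_cons _ _).1 hX.
rewrite (insertion_full 0 (X := [:: a; b]) sB kA).
rewrite (insertion_full 1 (X := [:: a; b]) sM kN).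
rewrite (insertion12 1 _ _ sA kB) (insertion12 0 _ _ sN kM) !l2E.
have := square_bracket_identity ha hb.
by case: a b ha hb {hX} => [? ?] [? ?].
Qed.

End Brackets.

(** * The co-boundary Nijenhuis property with its curvature and deformed structure *)

Unset Implicit Arguments.

Theorem proposition2p7p18 (R : realType) (n : nat) (M : smooth_manifold R n)
    (A : lie_algebroid M) (E : exterior_algebra A)
    (SN : E -> E -> E) (SN_spec : schouten_nijenhuis SN)
    (pi : E) (omega : two_form A)
    (pi_omega : PiOmega_structure SN pi omega)
    (pi_form : {scalar A} -> {scalar A} -> Cinf M)
    (pi_formE : bivector_as_form pi pi_form)
    (sharp : {scalar A} -> A)
    (sharpE : forall alpha beta : {scalar A},
        beta (sharp alpha) = pi_form alpha beta)
    (omu : E -> E -> E) (omu_spec : two_form_extension omega omu)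
    (Nu : E -> E)
    (Nu_spec : derivation_extension (sharp \o flat omega) Nu) :
  let calN : vform (over_reals E) := form_with_curvature omu pi in
  let mu : vform (over_reals E) := l2 SN in
  coboundary_nijenhuis (@shifted_degree R n M A E) mu calN
    (unary_form (Nu : over_reals E -> over_reals E)) /\
  curvature calN = pi /\
  form_eq (@shifted_degree R n M A E) (rn_bracket 0 1 calN mu)
    (fun X => - l1 SN pi X).
Proof.
have [hpi domega] := pi_omega; have [NuD _ _] := Nu_spec.
have omu_pi z P : homog z P -> omu pi P = - Nu P.
  exact: (omu_bivector omu_spec hpi.1 pi_formE sharpE Nu_spec).
split; [split|split].
- exact: l2_symmetric.
- exact: (curved_symmetric omu_spec hpi.1).
- exact: (Nu_symmetric omu_spec hpi NuD omu_pi).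
- exact: (square_bracket SN_spec omu_spec domega hpi NuD omu_pi).
- by rewrite /curvature /form_with_curvature /= add0r.
- exact: (deformed_bracket SN_spec omu_spec domega).
Qed.
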